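(* Let $G$ be a finite simple graph with no cycle of length congruent to $0$ or $1$ modulo $3$ (equivalently, no induced cycle of length $0$ or $1$ modulo $3$). If the independence complex $I(G)$ is not contractible, then $I(G)\simeq S^{d}$ for some $d\ge 0$ and $$d+1=i(G)=\gamma(G)=\gamma(L(G)).$$
   Context: All graphs are finite, simple and undirected; the length of a cycle is its number of edges. The independence complex $I(G)$ of a graph $G$ is the simplicial complex on $V(G)$ whose simplices are the independent sets of $G$. A graph is ternary if it has no induced cycle of length $0$ modulo $3$; it is known that the independence complex of a ternary graph is either contractible or homotopy equivalent to a sphere $S^d$, and $d(G)$ denotes this $d$ (or $*$ if $I(G)$ is contractible). A set $A\subseteq V(G)$ dominates $v$ if $v\in A$ or $v$ is adjacent to a vertex of $A$; $A$ is a dominating set if it dominates every vertex. $\gamma(G)$ is the minimum size of a dominating set, and $i(G)$ (the independent domination number) is the minimum size of an independent dominating set. $L(G)$ is the line graph of $G$. *)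

(* Defs.v *)
From HB Require Import structures.
From mathcomp Require Import all_boot all_order all_algebra.
From mathcomp Require Import all_classical all_reals all_analysis.
Import Order.TTheory GRing.Theory Num.Theory.
Import numFieldNormedType.Exports.

Set Implicit Arguments.
Unset Strict Implicit.
Unset Printing Implicit Defensive.

Local Open Scope classical_set_scope.
Local Open Scope ring_scope.

Record sgraph := SGraph {
  svertex :> finType;
  adj : rel svertex;
  adj_sym : symmetric adj;
  adj_irrefl : irreflexive adj }.

Section Graphs.
Variable G : sgraph.
Implicit Types (A : {set G}) (c : seq G).

Definition is_cycle c : bool := (2 < size c)%N && ucycleb (@adj G) c.

(* The only edges of G between vertices of c join cyclically consecutive
   vertices. *)
Definition is_induced_cycle c : bool :=
  is_cycle c &&
  [forall x, forall y, [&& x \in c, y \in c & adj x y] ==>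
     ((y == next c x) || (x == next c y))].

Definition length01mod3 c : Prop :=
  size c = 0 %[mod 3] \/ size c = 1 %[mod 3].

Definition no_cycle01mod3 : Prop :=
  forall c, is_cycle c -> ~ length01mod3 c.

Definition no_induced_cycle01mod3 : Prop :=
  forall c, is_induced_cycle c -> ~ length01mod3 c.

Definition independent A : bool :=
  [forall x in A, forall y in A, ~~ adj x y].

Definition dominates A (v : G) : bool :=
  (v \in A) || [exists u in A, adj u v].

Definition dominating A : bool := [forall v, dominates A v].

(* The default value #|G| of the iterated minima is harmless: every set has at
   most #|G| elements, and (independent) dominating sets exist since every
   maximal independent set is dominating. *)
Definition domination_number : nat :=
  \big[minn/#|G|]_(A : {set G} | dominating A) #|A|.

Definition independent_domination_number : nat :=
  \big[minn/#|G|]_(A : {set G} | independent A && dominating A) #|A|.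

Definition edges : {set {set G}} :=
  [set e : {set G} | [exists x, exists y, adj x y && (e == [set x; y]%SET)]]%SET.

Definition line_adj : rel {e : {set G} | e \in edges} :=
  fun e f => (e != f) && [exists x, (x \in val e) && (x \in val f)].

Fact line_adj_sym : symmetric line_adj.
Proof. by move=> e f; rewrite /line_adj eq_sym; congr andb; apply: eq_existsb => x; rewrite andbC. Qed.

Fact line_adj_irrefl : irreflexive line_adj.
Proof. by move=> e; rewrite /line_adj eqxx. Qed.

Definition line_graph : sgraph := SGraph line_adj_sym line_adj_irrefl.

End Graphs.

Record simplicial_complex (V : finType) := SimplicialComplex {
  simplices : {set {set V}};
  simplices_sub : forall A B : {set V},
    A \subset B -> B \in simplices -> A \in simplices }.

Section IndependenceComplex.
Variable G : sgraph.

Fact independent_sub (A B : {set G}) : A \subset B ->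
  B \in [set C : {set G} | independent C]%SET ->
  A \in [set C : {set G} | independent C]%SET.
Proof.
move=> /fintype.subsetP sAB; rewrite !inE => /forall_inP indB.
apply/forall_inP => x xA; apply/forall_inP => y yA.
by move/forall_inP: (indB x (sAB x xA)); apply; apply: sAB.
Qed.

Definition independence_complex : simplicial_complex G :=
  SimplicialComplex independent_sub.

End IndependenceComplex.

(* Points of the geometric realization, in barycentric coordinates: convex
   combinations of the standard basis of R^V whose support is a simplex of K. *)
Definition realization_set (R : realType) (V : finType)
    (K : simplicial_complex V) : set {ptws V -> R} :=
  [set x : {ptws V -> R} |
    [/\ forall v, 0 <= x v, \sum_v x v = 1 &
        [set v | x v != 0]%SET \in simplices K]].

Definition realization (R : realType) (V : finType)
    (K : simplicial_complex V) : topologicalType :=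
  set_type (@realization_set R V K).

Arguments realization R {V} K.

Definition sphere_set (R : realType) (d : nat) : set 'rV[R]_d.+1 :=
  [set x : 'rV[R]_d.+1 | \sum_i x ord0 i ^+ 2 = 1].

Definition sphere (R : realType) (d : nat) : topologicalType :=
  set_type (@sphere_set R d).

Section Homotopy.
Variable R : realType.

Definition homotopic (X Y : topologicalType) (f g : X -> Y) : Prop :=
  exists H : X * R -> Y,
    [/\ {within [set: X] `*` `[0, 1], continuous H},
        forall x, H (x, 0) = f x & forall x, H (x, 1) = g x].

Definition homotopy_equivalent (X Y : topologicalType) : Prop :=
  exists (f : X -> Y) (g : Y -> X),
    [/\ continuous f, continuous g,
        homotopic (g \o f) idfun & homotopic (f \o g) idfun].

Definition contractible (X : topologicalType) : Prop :=
  exists x0 : X, homotopic idfun (fun _ : X => x0).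

End Homotopy.

(* Main.v *)
Require Import Defs.
From mathcomp Require Import all_boot all_order all_algebra.
From mathcomp Require Import all_classical all_reals all_analysis.
From mathcomp Require Import fintype finset lra zify.
Import Order.TTheory GRing.Theory Num.Theory.
Import numFieldNormedType.Exports.

Set Implicit Arguments.
Unset Strict Implicit.
Unset Printing Implicit Defensive.

(** Edges between two disjoint vertex sets [P] and [Q] may be deleted without
    changing the homotopy type of the independence complex as soon as some
    vertex [t] outside [P] and [Q] satisfies [N(t) <= N(p) :|: N(q)] for all [p]
    in [P] and [q] in [Q]: in barycentric coordinates, mass on [P] and on [Q]
    cancels and moves to [t], and all homotopies are straight lines.

    Two reductions follow, both of which keep all cycle lengths equal to 2
    modulo 3 and decrease the number of edges.  If [b] is a leaf with neighbour
    [a], then [a] with all its neighbours can be cut off as a star.  If [b] and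
    [c] are adjacent vertices of degree 2 on a path [a b c v], then the other
    neighbours of [a] can be reattached to [v] while [a b c] becomes a component.
    A graph of minimum degree 2 all of whose cycles have length 2 modulo 3 has
    two adjacent vertices of degree 2; otherwise, suppressing its vertices of
    degree 2, a longest path in the resulting graph of minimum degree 3 (with
    edges of length 1 or 2) yields six cycles with contradictory lengths.  So the
    reductions end with an isolated vertex, and the complex is a cone, or with a
    forest of [k] stars, whose complex is the sphere of dimension [k - 1].  In
    the latter case [i(G) <= k <= gamma(L(G))] holds for the star forest and is
    transported back by both reductions.

    Finally [gamma(L(G)) <= gamma(G)]: given a dominating set [D], assign to each
    vertex outside [D] a neighbour in [D]; one can choose for every [v] in [D] a
    single vertex assigned to it so that the chosen vertices cover all edges
    outside [D], because walks [y v y' z w z' ...] alternating between the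
    assignment and such edges cannot close up modulo 3.  Hence
    [k <= gamma(L(G)) <= gamma(G) <= i(G) <= k]. *)

(** * Geometric realizations and independence complexes *)

Section Topology.
Local Open Scope classical_set_scope.
Local Open Scope ring_scope.

Section Realization.
Variables (R : realType) (V : finType).
Implicit Types (K L : simplicial_complex V).

Lemma ptws_continuous (X : topologicalType) (f : X -> {ptws V -> R}) :
  (forall v, continuous (fun x => f x v)) -> continuous f.
Proof.
move=> cf x; apply/cvg_sup => v.
by move: x; apply: continuous_comp_initial; apply: cf.
Qed.

Lemma realization_continuous (X : topologicalType) K (f : X -> realization R K) :
  (forall v, continuous (fun x => \val (f x) v)) -> continuous f.
Proof.
move=> cf; apply: continuous_comp_initial; apply: ptws_continuous.
by move=> v; apply: cf.
Qed.

Lemma coordinate_continuous K v :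
  continuous (fun x : realization R K => \val x v).
Proof.
move=> x; apply: (@continuous_comp _ _ _ (fun x : realization R K => \val x)
  (fun y : {ptws V -> R} => y v)).
  exact: initial_continuous.
exact: (@proj_continuous V (fun=> R) v).
Qed.

Lemma realizationP K (x : realization R K) : realization_set K (\val x).
Proof. by apply: set_mem; apply: valP. Qed.

Definition mk_realization K (x : V -> R) (xK : realization_set K x) :
  realization R K := SigSub (mem_set xK).

Lemma mk_realization_continuous (X : topologicalType) K (f : X -> V -> R)
    (fK : forall x, realization_set K (f x)) :
  (forall v, continuous (fun x => f x v)) ->
  continuous (fun x => mk_realization (fK x)).
Proof. by move=> cf; apply: realization_continuous. Qed.

End Realization.

(** * Continuity of real-valued functions *)

Section RealContinuity.
Variables (R : realType) (X : topologicalType).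
Implicit Types f g : X -> R.

Lemma cont_cst (a : R) : continuous (fun _ : X => a).
Proof. by move=> x; apply: cvg_cst. Qed.

Lemma cont_add f g : continuous f -> continuous g ->
  continuous (fun x => f x + g x).
Proof. by move=> cf cg x; apply: (@continuousD _ R^o); [apply: cf|apply: cg]. Qed.

Lemma cont_opp f : continuous f -> continuous (fun x => - f x).
Proof. by move=> cf x; apply: (@continuousN _ R^o); apply: cf. Qed.

Lemma cont_sub f g : continuous f -> continuous g ->
  continuous (fun x => f x - g x).
Proof. by move=> cf cg; apply: cont_add => //; apply: cont_opp. Qed.

Lemma cont_mul f g : continuous f -> continuous g ->
  continuous (fun x => f x * g x).
Proof. by move=> cf cg x; apply: continuousM; [apply: cf|apply: cg]. Qed.

Lemma cont_inv f : (forall x, f x != 0) -> continuous f ->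
  continuous (fun x => (f x)^-1).
Proof. by move=> f0 cf x; apply: continuousV; [apply: f0|apply: cf]. Qed.

Lemma cont_max f g : continuous f -> continuous g ->
  continuous (fun x => Num.max (f x) (g x)).
Proof. by move=> cf cg x; apply: continuous_max; [apply: cf|apply: cg]. Qed.

Lemma cont_min f g : continuous f -> continuous g ->
  continuous (fun x => Num.min (f x) (g x)).
Proof. by move=> cf cg x; apply: continuous_min; [apply: cf|apply: cg]. Qed.

Lemma cont_sum (I : Type) (r : seq I) (P : pred I) (F : I -> X -> R) :
  (forall i, continuous (F i)) ->
  continuous (fun x => \sum_(i <- r | P i) F i x).
Proof.
move=> cF; elim: r => [|i r IH].
  rewrite (_ : (fun _ => _) = fun=> 0); first exact: cont_cst.
  by apply/funext => x; rewrite big_nil.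
rewrite (_ : (fun _ => _) = fun x => (if P i then F i x else 0) +
  \sum_(j <- r | P j) F j x).
  by apply: cont_add => //; case: (P i) => //; apply: cont_cst.
by apply/funext => x; rewrite big_cons; case: (P i); rewrite ?add0r.
Qed.

End RealContinuity.

Lemma cont_comp (X Y Z : topologicalType) (f : X -> Y) (g : Y -> Z) :
  continuous f -> continuous g -> continuous (g \o f).
Proof. by move=> cf cg x; apply: continuous_comp; [apply: cf|apply: cg]. Qed.

Lemma cont_pair (X Y Z : topologicalType) (f : X -> Y) (g : X -> Z) :
  continuous f -> continuous g -> continuous (fun x => (f x, g x)).
Proof. by move=> cf cg x; apply: (@cvg_pair X Y Z); [apply: cf|apply: cg]. Qed.

Lemma cont_fst (X Y : topologicalType) : continuous (@fst X Y).
Proof. by move=> p; apply: cvg_fst. Qed.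

Lemma cont_snd (X Y : topologicalType) : continuous (@snd X Y).
Proof. by move=> p; apply: cvg_snd. Qed.

(** * Homotopies and homotopy equivalences *)

Section HomotopyTheory.
Variable R : realType.
Implicit Types W X Y Z : topologicalType.

(* Homotopies are only required to be continuous on [X * [0, 1]]; composing with
   [clip01] makes them continuous on [X * R]. *)
Definition clip01 (t : R) : R := Num.min 1 (Num.max 0 t).

Lemma clip01_continuous : continuous clip01.
Proof.
apply: cont_min; first exact: cont_cst.
by apply: cont_max; [apply: cont_cst|move=> t; apply: cvg_id].
Qed.

Lemma clip01_itv t : clip01 t \in `[0, 1].
Proof.
rewrite in_itv /= /clip01 le_min ge_min lexx /= andbT ler01 /=.
by rewrite le_max lexx.
Qed.

Lemma clip01_0 : clip01 0 = 0.
Proof. by rewrite /clip01 maxxx min_r. Qed.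

Lemma clip01_1 : clip01 1 = 1.
Proof. by rewrite /clip01 max_r ?ler01// minxx. Qed.

Lemma homotopicP X Y (f g : X -> Y) :
  homotopic R f g <-> exists H : X * R -> Y,
    [/\ continuous H, forall x, H (x, 0) = f x & forall x, H (x, 1) = g x].
Proof.
split=> -[H [cH H0 H1]]; last first.
  by exists H; split=> //; apply: continuous_subspaceT.
pose c (p : X * R) : X * R := (p.1, clip01 p.2).
have cc : continuous c.
  apply: cont_pair; first exact: cont_fst.
  by apply: cont_comp; [exact: cont_snd|exact: clip01_continuous].
exists (H \o c); split=> [p U nU|x|x] /=; rewrite /c /= ?clip01_0 ?clip01_1//.
have Ac : ([set: X] `*` `[0, 1]) (c p) by split=> //; exact: clip01_itv.
have := cH (c p) U nU; rewrite /nbhs /= -nbhs_subspace_in// => W.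
apply: (@filterS _ (nbhs p) _ _ _ _ (cc p _ W)) => q; apply.
by split=> //; exact: clip01_itv.
Qed.

Lemma homotopic_sym X Y (f g : X -> Y) : homotopic R f g -> homotopic R g f.
Proof.
case/homotopicP=> H [cH H0 H1]; apply/homotopicP.
exists (fun p => H (p.1, 1 - p.2)); split=> [p|x|x] /=.
- apply: (@cont_comp _ _ _ (fun p : X * R => (p.1, 1 - p.2)) H _ cH p).
  apply: cont_pair; first exact: cont_fst.
  by apply: cont_sub; [exact: cont_cst|exact: cont_snd].
- by rewrite subr0 H1.
- by rewrite subrr H0.
Qed.

Lemma homotopic_trans X Y (f g h : X -> Y) :
  homotopic R f g -> homotopic R g h -> homotopic R f h.
Proof.
case/homotopicP=> H [cH H0 H1] /homotopicP[K [cK K0 K1]]; apply/homotopicP.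
pose F (p : X * R) := if p.2 <= 2^-1 then H (p.1, 2 * p.2) else K (p.1, 2 * p.2 - 1).
exists F; split=> [|x|x]; last 2 first.
- by rewrite /F /= invr_ge0 ler0n mulr0.
- by rewrite /F /= leNgt invf_lt1 ?ltr1n ?ltr0n //= mulr1 [2]mulr2n addrK.
(* The two halves are closed and cover [X * R], so continuity may be checked on each of them. *)
pose A := (snd : X * R -> R) @^-1` [set t | t <= 2^-1].
pose B := (snd : X * R -> R) @^-1` [set t | 2^-1 <= t].
have csnd : continuous (snd : X * R -> R) by move=> p; apply: cvg_snd.
have clA : closed A.
  by apply: preimage_closed; [move=> ? _; apply: csnd|exact: closed_le].
have clB : closed B.
  by apply: preimage_closed; [move=> ? _; apply: csnd|exact: closed_ge].
have AB : A `|` B = [set: X * R].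
  by apply/seteqP; split=> // p _; rewrite /A /B /=; apply/orP/le_total.
apply/continuous_subspace_setT; rewrite -AB; apply: withinU_continuous => //.
  apply: (@subspace_eq_continuous _ _ _ (fun p : X * R => H (p.1, 2 * p.2))).
    by move=> p; rewrite in_setE /A /= => pA; rewrite /F /from_subspace pA.
  apply: (@continuous_subspaceT _ _ A (fun p : X * R => H (p.1, 2 * p.2))).
  apply: (cont_comp (f := fun p : X * R => (p.1, 2 * p.2))) => //.
  apply: cont_pair; first exact: cont_fst.
  by apply: cont_mul => //; apply: cont_cst.
apply: (@subspace_eq_continuous _ _ _ (fun p : X * R => K (p.1, 2 * p.2 - 1))).
  move=> p; rewrite in_setE /B /F /from_subspace /= le_eqVlt => /orP[/eqP pE|pB]; last first.
    by rewrite leNgt pB.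
  by rewrite -pE lexx mulfV ?pnatr_eq0// subrr H1 K0.
apply: (@continuous_subspaceT _ _ B (fun p : X * R => K (p.1, 2 * p.2 - 1))).
apply: (cont_comp (f := fun p : X * R => (p.1, 2 * p.2 - 1))) => //.
apply: cont_pair; first exact: cont_fst.
by apply: cont_sub; [apply: cont_mul => //|]; apply: cont_cst.
Qed.

Lemma homotopic_comp X Y Z W (f g : X -> Y) (h : W -> X) (k : Y -> Z) :
  continuous h -> continuous k ->
  homotopic R f g -> homotopic R (k \o f \o h) (k \o g \o h).
Proof.
move=> ch ck /homotopicP[H [cH H0 H1]]; apply/homotopicP.
exists (fun p => k (H (h p.1, p.2))); split=> [|x|x] /=; rewrite ?H0 ?H1//.
apply: (cont_comp (f := fun p : W * R => H (h p.1, p.2))) => //.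
apply: (cont_comp (f := fun p : W * R => (h p.1, p.2))) => //.
apply: cont_pair; last exact: cont_snd.
by apply: (cont_comp (f := fst)) => //; exact: cont_fst.
Qed.

Local Notation "X ~= Y" := (homotopy_equivalent R X Y) (at level 70).

Lemma homotopy_equivalent_sym X Y : X ~= Y -> Y ~= X.
Proof. by case=> f [g [cf cg gf fg]]; exists g, f. Qed.

Lemma homotopy_equivalent_trans X Y Z : X ~= Y -> Y ~= Z -> X ~= Z.
Proof.
case=> f [g [cf cg gf fg]] [f' [g' [cf' cg' gf' fg']]].
exists (f' \o f), (g \o g'); split; try by apply: cont_comp.
  exact: homotopic_trans (homotopic_comp cf cg gf') gf.
exact: homotopic_trans (homotopic_comp cg' cf' fg) fg'.
Qed.

Lemma contractible_equivalent X Y :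
  X ~= Y -> contractible R Y -> contractible R X.
Proof.
case=> f [g [cf cg gf fg]] [y0 hy]; exists (g y0).
exact: homotopic_trans (homotopic_sym gf) (homotopic_comp cf cg hy).
Qed.

End HomotopyTheory.

(** * Straight-line homotopies in a realization *)

Section LinearHomotopy.
Variables (R : realType) (V : finType).
Implicit Types (K L : simplicial_complex V).

Definition supp (x : V -> R) : {set V} := [set v | x v != 0]%SET.

(** A convex combination of two points has its support inside the union of their supports; when that
    union is a simplex, the segment stays in the realization. *)
Lemma linear_homotopic (X : topologicalType) K (f g : X -> realization R K) :
  continuous f -> continuous g ->
  (forall x, (supp (\val (f x)) :|: supp (\val (g x)))%SET \in simplices K) ->
  homotopic R f g.
Proof.
move=> cf cg fgK.
pose h (p : X * R) v :=
  (1 - clip01 p.2) * \val (f p.1) v + clip01 p.2 * \val (g p.1) v.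
have hK p : realization_set K (h p).
  have [f0 f1 _] := realizationP (f p.1); have [g0 g1 _] := realizationP (g p.1).
  have := clip01_itv p.2; rewrite in_itv /= => /andP[c0 c1].
  split=> [v||].
  - by rewrite addr_ge0 ?mulr_ge0 ?subr_ge0.
  - by rewrite big_split /= -!mulr_sumr f1 g1 !mulr1 subrK.
  apply: simplices_sub (fgK p.1); apply/fintype.subsetP => v.
  rewrite !inE /h; apply: contraNT; rewrite negb_or !negbK.
  by case/andP=> /eqP-> /eqP->; rewrite !mulr0 addr0.
apply/homotopicP; exists (fun p => mk_realization (hK p)); split=> [|x|x].
- apply: mk_realization_continuous => v.
  have cc : continuous (fun p : X * R => clip01 p.2).
    by apply: cont_comp; [exact: cont_snd|exact: clip01_continuous].
  apply: cont_add; apply: cont_mul => //.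
  + by apply: cont_sub => //; apply: cont_cst.
  + apply: (cont_comp (f := fun p => f p.1) (g := fun x => \val x v)).
      by apply: cont_comp => //; exact: cont_fst.
    exact: coordinate_continuous.
  + apply: (cont_comp (f := fun p => g p.1) (g := fun x => \val x v)).
      by apply: cont_comp => //; exact: cont_fst.
    exact: coordinate_continuous.
- apply: val_inj; apply/funext => v /=.
  by rewrite /h /= clip01_0 subr0 mul1r mul0r addr0.
- apply: val_inj; apply/funext => v /=.
  by rewrite /h /= clip01_1 subrr mul1r mul0r add0r.
Qed.

Lemma cone_contractible K t : [set t]%SET \in simplices K ->
  (forall s, s \in simplices K -> (t |: s)%SET \in simplices K) ->
  contractible R (realization R K).
Proof.
move=> tK cK; pose d (v : V) : R := (v == t)%:R.
have dK : realization_set K d.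
  split=> [v||]; first by rewrite ler0n.
    rewrite (bigD1 t)//= /d eqxx big1 ?addr0// => v /negPf ->.
    by [].
  rewrite [X in X \in _](_ : _ = [set t]%SET)//; apply/setP => v.
  by rewrite !inE /d pnatr_eq0 eqb0 negbK.
exists (mk_realization dK); apply: linear_homotopic;
  [by move=> ? ?|exact: cst_continuous|move=> x].
have [_ _ xK] := realizationP x.
rewrite (_ : supp _ :|: _ = t |: supp (\val x))%SET; first exact: cK.
by apply/setP => v; rewrite !inE /= /d pnatr_eq0 eqb0 negbK orbC.
Qed.

(** [f] and [g] are bare functions on coordinates, so that no membership proofs enter their
    definitions; their continuity is tested on families with continuous coordinates. The last two
    hypotheses make both composites homotopic to the identity along straight lines. *)
Lemma supp_homotopy_equivalent K L (f g : (V -> R) -> V -> R) :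
  (forall x, realization_set K x -> realization_set L (f x)) ->
  (forall y, realization_set L y -> realization_set K (g y)) ->
  (forall (X : topologicalType) (h : X -> V -> R),
     (forall v, continuous (h^~ v)) -> forall v, continuous (fun x => f (h x) v)) ->
  (forall (X : topologicalType) (h : X -> V -> R),
     (forall v, continuous (h^~ v)) -> forall v, continuous (fun x => g (h x) v)) ->
  (forall x, realization_set K x -> (supp (g (f x)) :|: supp x)%SET \in simplices K) ->
  (forall y, realization_set L y -> (supp (f (g y)) :|: supp y)%SET \in simplices L) ->
  homotopy_equivalent R (realization R K) (realization R L).
Proof.
move=> fKL gLK cf cg gfK fgL.
pose F x := mk_realization (fKL _ (@realizationP R V K x)).
pose G y := mk_realization (gLK _ (@realizationP R V L y)).
have cF : continuous F.
  by apply: mk_realization_continuous; apply: cf; exact: coordinate_continuous.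
have cG : continuous G.
  by apply: mk_realization_continuous; apply: cg; exact: coordinate_continuous.
exists F, G; split=> //; apply: linear_homotopic.
- exact: cont_comp.
- by move=> ? ?.
- by move=> x; apply: gfK; exact: realizationP.
- exact: cont_comp.
- by move=> ? ?.
- by move=> x; apply: fgL; exact: realizationP.
Qed.

End LinearHomotopy.

(** * Deleting the edges between two sets of vertices *)

Section Toggle.
Variables (R : realType) (V : finType).
Variables (e e' : rel V) (es : symmetric e) (ei : irreflexive e).
Variables (es' : symmetric e') (ei' : irreflexive e').
Variables (P Q : {set V}) (t : V).

(* Mass of [P] and mass of [Q] cancel each other until one of them is used up;
   the mass which is lost goes to [t]. *)
Definition cancel_off (x : V -> R) (v : V) : R :=
  if v \in P then Num.max 0 (x v - \sum_(w in Q) x w) else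
  if v \in Q then Num.max 0 (x v - \sum_(w in P) x w) else x v.

Definition cancel_mass (x : V -> R) (v : V) : R :=
  if v == t then 1 - \sum_(w | w != t) cancel_off x w else cancel_off x v.

Lemma cancel_mass_continuous (X : topologicalType) (h : X -> V -> R) :
  (forall v, continuous (h^~ v)) ->
  forall v, continuous (fun x => cancel_mass (h x) v).
Proof.
move=> ch.
have c0 : continuous (fun _ : X => 0 : R) by exact: cont_cst.
have co v : continuous (fun x => cancel_off (h x) v).
  rewrite /cancel_off; case: (v \in P); last case: (v \in Q) => //;
  by apply: cont_max => //; apply: cont_sub => //; apply: cont_sum => w.
move=> v; rewrite /cancel_mass; case: (v == t) => //.
by apply: cont_sub; [apply: cont_cst|apply: cont_sum].
Qed.

Hypotheses (PQ : forall v, v \in P -> v \in Q -> False) (tP : t \notin P) (tQ : t \notin Q).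

Section Point.
Variable x : V -> R.
Hypotheses (x0 : forall v, 0 <= x v) (x1 : \sum_v x v = 1).

Lemma cancel_off_ge0 v : 0 <= cancel_off x v.
Proof. by rewrite /cancel_off; do 2?case: ifP => _; rewrite ?le_max ?lexx. Qed.

Lemma cancel_off_le v : cancel_off x v <= x v.
Proof.
by rewrite /cancel_off; do 2?case: ifP => _ //;
  rewrite ge_max x0 gerBl sumr_ge0.
Qed.

Lemma cancel_mass_ge0 v : 0 <= cancel_mass x v.
Proof.
rewrite /cancel_mass; case: ifP => _; last exact: cancel_off_ge0.
rewrite subr_ge0 -x1 [leRHS](bigD1 t)//= addrC.
by apply: ler_wpDr => //; apply: ler_sum => w _; exact: cancel_off_le.
Qed.

Lemma cancel_mass_sum : \sum_v cancel_mass x v = 1.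
Proof.
rewrite (bigD1 t)//= {1}/cancel_mass eqxx.
by rewrite (eq_bigr (cancel_off x)) ?subrK// => v /negPf vt; rewrite /cancel_mass vt.
Qed.

Lemma cancel_mass_supp : (supp (cancel_mass x) \subset t |: supp x)%SET.
Proof.
apply/fintype.subsetP => v; rewrite !inE /cancel_mass.
have [//|_ /=] := eqVneq v t; apply: contra_neq => xv.
by apply/le_anti; rewrite cancel_off_ge0// -xv cancel_off_le.
Qed.

(** If both survived, [x p] would exceed the mass of [Q], hence [x q], and symmetrically [x q] would
    exceed [x p]. *)
Lemma cancel_mass_sep p q : p \in P -> q \in Q ->
  p \in supp (cancel_mass x) -> q \in supp (cancel_mass x) -> False.
Proof.
move=> pP qQ; rewrite !inE /cancel_mass.
have [pt|_] := eqVneq p t; first by move: tP; rewrite -pt pP.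
have [qt|_] := eqVneq q t; first by move: tQ; rewrite -qt qQ.
have qP : (q \in P) = false by apply/negP => /PQ; apply.
rewrite /cancel_off pP qP qQ => hp hq.
have lt z (A : {set V}) (zA : Num.max 0 (x z - \sum_(w in A) x w) != 0) :
    \sum_(w in A) x w < x z.
  by rewrite -subr_gt0 ltNge; apply: contraNN zA => h; rewrite max_l.
have {}hp := lt _ _ hp; have {}hq := lt _ _ hq.
have sp : x p <= \sum_(w in P) x w.
  by rewrite (bigD1 p)//= lerDl sumr_ge0.
have sq : x q <= \sum_(w in Q) x w.
  by rewrite (bigD1 q)//= lerDl sumr_ge0.
by move: hp hq sp sq; lra.
Qed.

Lemma cancel_mass_id : (forall v, v \in P -> x v = 0) \/ (forall v, v \in Q -> x v = 0) ->
  cancel_mass x = x.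
Proof.
move=> d; have off v : cancel_off x v = x v.
  rewrite /cancel_off; case: ifP => vP; [|case: ifP => vQ //].
    case: d => d; first by rewrite d// max_l// subr_le0 sumr_ge0.
    by rewrite big1 ?subr0 ?max_r// => w wQ; exact: d.
  case: d => d; last by rewrite d// max_l// subr_le0 sumr_ge0.
  by rewrite big1 ?subr0 ?max_r// => w wP; exact: d.
apply/funext => v; rewrite /cancel_mass; case: eqVneq => [->|_]//.
by rewrite (eq_bigr x) // -x1 (bigD1 t)//= addrK.
Qed.

End Point.

Hypothesis e'e : forall x y, e' x y -> e x y.
Hypothesis ee' : forall x y, e x y ->
  [\/ e' x y, (x \in P) && (y \in Q) | (x \in Q) && (y \in P)].
Hypothesis et : forall p q z, p \in P -> q \in Q -> e t z -> e' p z || e' q z.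

Let K := independence_complex (SGraph es ei).
Let L := independence_complex (SGraph es' ei').

Lemma indepP (f : rel V) (fs : symmetric f) (fi : irreflexive f) (A : {set V}) :
  reflect {in A &, forall x y, ~~ f x y}
    (A \in simplices (independence_complex (SGraph fs fi))).
Proof.
rewrite inE; apply: (iffP forall_inP) => [h x y xA yA|h x xA].
  by move/forall_inP: (h _ xA); apply.
by apply/forall_inP => y yA; apply: h.
Qed.

(** [f] ranges over the graphs between [e'] and [e], which covers both composites of the
    equivalence. If [x] charges some [p] in [P] and some [q] in [Q], every neighbour of [t] is
    adjacent to [p] or to [q], so [t] can join the support; otherwise nothing is cancelled. *)
Lemma indep_cancel (f : rel V) (fs : symmetric f) (fi : irreflexive f) x :
  (forall x y, f x y -> e x y) -> (forall x y, e' x y -> f x y) ->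
  realization_set (independence_complex (SGraph fs fi)) x ->
  (supp (cancel_mass x) :|: supp x)%SET \in
    simplices (independence_complex (SGraph fs fi)).
Proof.
move=> fe e'f [x0 x1 xf]; rewrite -/(supp x) in xf.
have [/forall_inP d|] := boolP [forall v in P, x v == 0].
  rewrite cancel_mass_id ?finset.setUid//; left=> v vP; exact/eqP/d.
case/forall_inPn=> p pP pS.
have [/forall_inP d|] := boolP [forall v in Q, x v == 0].
  rewrite cancel_mass_id ?finset.setUid//; right=> v vQ; exact/eqP/d.
case/forall_inPn=> q qQ qS.
have {}pS : p \in supp x by rewrite inE.
have {}qS : q \in supp x by rewrite inE.
suff : (t |: supp x)%SET \in simplices (independence_complex (SGraph fs fi)).
  apply: simplices_sub; rewrite finset.subUset cancel_mass_supp//.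
  by apply/fintype.subsetP => v; rewrite !inE orbC => ->.
move/indepP: xf => xf.
have tx z : z \in supp x -> ~~ f t z.
  move=> zS; apply/negP => /fe /(et pP qQ) /orP[] /e'f fz.
    by have := xf p z pS zS; rewrite fz.
  by have := xf q z qS zS; rewrite fz.
apply/indepP => u v /setU1P[->|uS] /setU1P[->|vS].
- by rewrite fi.
- exact: tx.
- by rewrite fs tx.
- exact: xf.
Qed.

(** Since [e] contains [e'], [K] is a subcomplex of [L]; the inclusion and [cancel_mass] are
    mutually inverse up to straight-line homotopy. *)
Lemma toggle_equivalent :
  homotopy_equivalent R (realization R K) (realization R L).
Proof.
apply: (@supp_homotopy_equivalent R V K L id cancel_mass) => //.
- move=> x [x0 x1 /indepP xK]; split=> //; apply/indepP => u v uS vS.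
  by apply: contraNN (xK _ _ uS vS); exact: e'e.
- move=> x xL; have [x0 x1 _] := xL.
  split; [exact: cancel_mass_ge0|exact: cancel_mass_sum|].
  have /indepP sL := indep_cancel e'e (fun _ _ => id) xL.
  apply/indepP => u v uS vS; apply/negP => /ee'[e'uv|/andP[uP vQ]|/andP[uQ vP]].
  + by have := sL u v; rewrite !(finset.in_setU) uS vS e'uv => /(_ isT isT).
  + exact: cancel_mass_sep uP vQ uS vS.
  + exact: cancel_mass_sep vP uQ vS uS.
- exact: cancel_mass_continuous.
- by move=> x xK; apply: indep_cancel.
- by move=> x xL; apply: indep_cancel.
Qed.

End Toggle.

Lemma homotopic_refl (R : realType) (X Y : topologicalType) (f : X -> Y) :
  continuous f -> homotopic R f f.
Proof.
move=> cf; apply/homotopicP; exists (f \o fst); split=> //.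
by apply: cont_comp => //; exact: cont_fst.
Qed.

Lemma rV_continuous (R : realType) (X : topologicalType) n (f : X -> 'rV[R]_n) :
  (forall i, continuous (fun x => f x ord0 i)) -> continuous f.
Proof.
move=> cf x; apply/cvg_ballP => eps eps0.
rewrite /ball /= /mx_ball.
near=> y; split=> // i j; rewrite (ord1 i).
move: j; near: y; apply: filter_forall => j.
have /cvg_ballP/(_ _ eps0) := cf j x; apply: filterS => y //.
Unshelve. all: by end_near. Qed.

Lemma max0_add (R : realDomainType) (r : R) :
  Num.max 0 r + Num.max 0 (- r) = `|r|.
Proof.
have [h|h] := leP 0 r.
  by rewrite ger0_norm// max_l ?oppr_le0// addr0.
by rewrite ltr0_norm// max_r ?oppr_ge0 ?ltW// add0r.
Qed.

Section Isolated.
Variables (R : realType) (V : finType) (e : rel V).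
Variables (es : symmetric e) (ei : irreflexive e) (t : V).

(** An isolated [t] can be added to every independent set, so the complex is a cone with apex
    [t]. *)
Lemma isolated_contractible : (forall x, ~~ e t x) ->
  contractible R (realization R (independence_complex (SGraph es ei))).
Proof.
move=> et; apply: (@cone_contractible _ _ _ t).
  by apply/indepP => x y /set1P-> /set1P->; rewrite et.
move=> s /indepP sI; apply/indepP => x y /setU1P[->|xs] /setU1P[->|ys] //.
  by rewrite es.
exact: sI.
Qed.

End Isolated.

(** * Independence complexes of star forests *)

Section StarForest.
Variables (R : realType) (V : finType) (d : nat).
Variables (k : V -> 'I_d.+1) (a l : 'I_d.+1 -> V).
Hypotheses (ka : cancel a k) (kl : cancel l k) (al : forall i, l i != a i).

(** The map [k] numbers the components, [a i] is the centre of component [i] and [l i] one chosen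
    leaf; exactly one end of an edge is a centre. *)
Definition star_rel : rel V :=
  fun x y => (k x == k y) && ((x == a (k x)) (+) (y == a (k y))).

Lemma star_sym : symmetric star_rel.
Proof. by move=> x y; rewrite /star_rel eq_sym addbC. Qed.

Lemma star_irrefl : irreflexive star_rel.
Proof. by move=> x; rewrite /star_rel addbb andbF. Qed.

Let K := independence_complex (SGraph star_sym star_irrefl).

Lemma star_indep (x : V -> R) : supp x \in simplices K -> forall v w,
  x v != 0 -> x w != 0 -> k v = k w -> v = a (k v) -> w = a (k w).
Proof.
move=> /indepP xK v w xv xw kvw va.
have := xK v w; rewrite !inE xv xw /star_rel kvw eqxx -kvw -va eqxx /=.
by move/(_ isT isT); rewrite negbK => /eqP ->.
Qed.

(** A point of the complex charges the centre or the leaves of a star, never both: the sign tells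
    which side carries the mass, and the absolute value how much. *)
Definition star_coord (x : V -> R) (i : 'I_d.+1) : R :=
  x (a i) - \sum_(v | (k v == i) && (v != a i)) x v.

Definition star_norm2 x := \sum_i star_coord x i ^+ 2.

Lemma star_norm2_gt0 (x : V -> R) : realization_set K x -> 0 < star_norm2 x.
Proof.
move=> [x0 x1 xK]; rewrite lt_def sumr_ge0 ?andbT; last first.
  by move=> i _; rewrite sqr_ge0.
apply/negP => /eqP N0.
have c0 i : star_coord x i = 0.
  apply/eqP; rewrite -sqrf_eq0; apply/eqP.
  by apply: (psumr_eq0P _ N0) => // j _; rewrite sqr_ge0.
suff x00 v : x v = 0.
  by move: x1; rewrite big1 // => /eqP; rewrite eq_sym oner_eq0.
(* A charged centre forbids charged leaves, so the coordinate would equal the mass at the centre. *)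
have ai i : x (a i) = 0.
  apply/eqP; apply/negP => /negP ai0.
  have := c0 i; rewrite /star_coord big1 ?subr0; first exact/eqP.
  move=> w /andP[/eqP kw /eqP wa]; apply/eqP; apply/negP => /negP xw.
  by apply: wa; rewrite -kw; apply: (star_indep xK ai0 xw); rewrite !ka.
have [->|va] := eqVneq v (a (k v)); first exact: ai.
have /eqP := c0 (k v); rewrite /star_coord ai sub0r oppr_eq0 => /eqP s0.
by apply: (psumr_eq0P _ s0) => // ; rewrite eqxx.
Qed.

Definition star_sphere (x : V -> R) : 'rV[R]_d.+1 :=
  \row_i (star_coord x i / Num.sqrt (star_norm2 x)).

Lemma star_sphereP x : realization_set K x -> sphere_set (star_sphere x).
Proof.
move=> /star_norm2_gt0 N0; rewrite /sphere_set /=.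
under eq_bigr do rewrite mxE expr_div_n.
by rewrite -mulr_suml sqr_sqrtr ?ltW// divff// gt_eqF.
Qed.

Definition norm1 (y : 'rV[R]_d.+1) : R := \sum_i `|y ord0 i|.

Lemma norm1_gt0 y : sphere_set y -> 0 < norm1 y.
Proof.
rewrite /sphere_set /= => y1; rewrite lt_def sumr_ge0 // andbT.
apply/negP => /eqP y0; have := oner_neq0 R; rewrite -y1 big1 ?eqxx// => i _.
apply/eqP; rewrite sqrf_eq0 -normr_eq0; apply/eqP.
by apply: (psumr_eq0P _ y0).
Qed.

(** Homotopy inverse of [star_sphere]: the positive part of a coordinate goes to the centre and the
    negative part to the chosen leaf; dividing by [norm1] makes the total mass one. *)
Definition sphere_star (y : 'rV[R]_d.+1) (v : V) : R :=
  if v == a (k v) then Num.max 0 (y ord0 (k v)) / norm1 y else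
  if v == l (k v) then Num.max 0 (- y ord0 (k v)) / norm1 y else 0.

Lemma sphere_star_a y i : sphere_star y (a i) = Num.max 0 (y ord0 i) / norm1 y.
Proof. by rewrite /sphere_star ka eqxx. Qed.

Lemma sphere_star_l y i : sphere_star y (l i) = Num.max 0 (- y ord0 i) / norm1 y.
Proof. by rewrite /sphere_star kl eqxx (negPf (al i)). Qed.

Lemma sphere_star_leaves y i :
  \sum_(v | (k v == i) && (v != a i)) sphere_star y v =
  Num.max 0 (- y ord0 i) / norm1 y.
Proof.
rewrite (bigD1 (l i)) /= ?kl ?eqxx ?al// sphere_star_l big1 ?addr0//.
move=> v /andP[/andP[/eqP kv va] vl].
by rewrite /sphere_star kv (negPf va) (negPf vl).
Qed.

Lemma sphere_star_ge0 y v : 0 <= sphere_star y v.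
Proof.
have n0 : 0 <= norm1 y by apply: sumr_ge0.
rewrite /sphere_star; case: ifP => _; [|case: ifP => _ //];
by rewrite divr_ge0// le_max lexx.
Qed.

Lemma sphere_starP y : sphere_set y -> realization_set K (sphere_star y).
Proof.
move=> /norm1_gt0 n0; split; first exact: sphere_star_ge0.
  rewrite (partition_big k predT)//=.
  under eq_bigr => i _.
    rewrite (bigD1 (a i)) /= ?ka ?eqxx// sphere_star_leaves sphere_star_a.
    rewrite -mulrDl max0_add; over.
  by rewrite -mulr_suml divff// gt_eqF.
have pos v w : sphere_star y v != 0 -> sphere_star y w != 0 -> k v = k w ->
    v = a (k v) -> w <> a (k w) -> False.
  move=> hv hw kvw va /eqP wa; move: hv hw.
  rewrite /sphere_star -va eqxx (negPf wa) kvw.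
  case: ifP => _; last by rewrite eqxx.
  by rewrite !mulf_eq0 !invr_eq0 (gt_eqF n0) !orbF maxEle maxEle; do 2!case: ifP; lra.
apply/indepP => v w; rewrite !inE => hv hw.
apply/negP => /andP[/eqP kvw].
case: eqP => va; case: eqP => wa // _; first exact: pos hv hw kvw va wa.
exact: pos hw hv (esym kvw) wa va.
Qed.

Lemma star_coordK y i : star_coord (sphere_star y) i = y ord0 i / norm1 y.
Proof.
rewrite /star_coord sphere_star_leaves sphere_star_a -mulrBl; congr (_ / _).
by rewrite !maxEle; do 2!case: ifP; lra.
Qed.

(** Both maps only rescale the signed coordinates by positive factors, and [y] already has Euclidean
    norm one. *)
Lemma star_sphereK y : sphere_set y -> star_sphere (sphere_star y) = y.
Proof.
move=> ys; have n0 := norm1_gt0 ys; apply/rowP => i; rewrite mxE star_coordK.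
rewrite /star_norm2; under eq_bigr do rewrite star_coordK expr_div_n.
rewrite -mulr_suml (ys : \sum_i _ = _) mul1r -exprVn sqrtr_sqr ger0_norm.
  by rewrite invrK divfK// gt_eqF.
by rewrite invr_ge0 ltW.
Qed.

(** The new point charges the centre of a star only if [x] does, and a leaf only if [x] charges some
    leaf of the same star; hence the union of the supports contains no edge. *)
Lemma star_supp x : realization_set K x ->
  (supp (sphere_star (star_sphere x)) :|: supp x)%SET \in simplices K.
Proof.
move=> xK; have N0 := star_norm2_gt0 xK; have [x0 x1 xI] := xK.
have s0 := norm1_gt0 (star_sphereP xK).
have q0 : 0 < Num.sqrt (star_norm2 x) by rewrite sqrtr_gt0.
have c0 v : v \in (supp (sphere_star (star_sphere x)) :|: supp x)%SET ->
    v = a (k v) -> x (a (k v)) != 0.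
  rewrite !inE => /orP[|+ <-//] => + va.
  rewrite /sphere_star -va eqxx mulf_eq0 invr_eq0 (gt_eqF s0) orbF mxE.
  apply: contraNN => /eqP xv; rewrite max_l// /star_coord -va xv sub0r mulNr.
  by rewrite oppr_le0 divr_ge0 ?sumr_ge0// ltW.
have l0 v : v \in (supp (sphere_star (star_sphere x)) :|: supp x)%SET ->
    v <> a (k v) -> exists2 w, (k w = k v) /\ (w != a (k v)) & x w != 0.
  move=> + /eqP va; rewrite !inE => /orP[|xv]; last by exists v.
  rewrite /sphere_star (negPf va); case: (v == l (k v)); last by rewrite eqxx.
  rewrite mulf_eq0 invr_eq0 (gt_eqF s0) orbF mxE => h.
  have [/existsP[w /andP[/andP[/eqP kw wa] xw]]|] :=
    boolP [exists w, (k w == k v) && (w != a (k v)) && (x w != 0)].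
    by exists w.
  move=> /existsPn nw; move: h; rewrite /star_coord big1 ?subr0.
    by rewrite max_l ?eqxx// oppr_le0 divr_ge0// ltW.
  by move=> w wP; apply/eqP; move: (nw w); rewrite wP negbK.
have sep v w : v \in (supp (sphere_star (star_sphere x)) :|: supp x)%SET ->
    w \in (supp (sphere_star (star_sphere x)) :|: supp x)%SET ->
    k v = k w -> v = a (k v) -> w <> a (k w) -> False.
  move=> vS wS kvw va wa; have xa := c0 _ vS va.
  have [u [ku /eqP ua] xu] := l0 _ wS wa.
  apply: ua; rewrite -ku.
  by apply: (star_indep xI xa xu); rewrite !ka ?kvw ?ku.
apply/indepP => v w vS wS; apply/negP => /andP[/eqP kvw].
case: eqP => va; case: eqP => wa // _; first exact: sep vS wS kvw va wa.
exact: sep wS vS (esym kvw) wa va.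
Qed.

Lemma star_forest_sphere :
  homotopy_equivalent R (realization R K) (sphere R d).
Proof.
pose F (x : realization R K) : sphere R d :=
  SigSub (mem_set (star_sphereP (realizationP x))).
have sP (y : sphere R d) : sphere_set (\val y) by apply/set_mem/valP.
pose G (y : sphere R d) := mk_realization (sphere_starP (sP y)).
have cF : continuous F.
  apply: continuous_comp_initial; apply: rV_continuous => i /=.
  have cv := @coordinate_continuous R V K.
  have cc j : continuous (fun x : realization R K => star_coord (\val x) j).
    by apply: cont_sub => //; apply: cont_sum.
  under [X in continuous X]eq_fun => x do rewrite /F /= mxE.
  apply: cont_mul => //; apply: cont_inv.
    by move=> x; rewrite gt_eqF// sqrtr_gt0 star_norm2_gt0//; exact: realizationP.
  apply: (cont_comp (f := fun x : realization R K => star_norm2 (\val x))).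
    by apply: cont_sum => j; apply: cont_mul.
  exact: sqrt_continuous.
have cv i : continuous (fun y : sphere R d => \val y ord0 i).
  apply: (cont_comp (f := fun y : sphere R d => \val y)
    (g := fun z : 'rV[R]_d.+1 => z ord0 i)); first exact: initial_continuous.
  exact: coord_continuous.
have cG : continuous G.
  apply: mk_realization_continuous => v; rewrite /sphere_star.
  have cn : continuous (fun y : sphere R d => (norm1 (\val y))^-1).
    apply: cont_inv; first by move=> y; rewrite gt_eqF// norm1_gt0.
    apply: cont_sum => j; apply: (cont_comp (cv j)).
    exact: norm_continuous.
  have c0 : continuous (fun _ : sphere R d => 0 : R) by exact: cont_cst.
  case: (v == a (k v)); last case: (v == l (k v)) => //;
  by apply: cont_mul => //; apply: cont_max => //; apply: cont_opp.
(* [G \o F] gathers the leaf mass of each star on one leaf and is joined to the identity by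
   segments; [F \o G] is the identity itself. *)
exists F, G; split=> //.
  apply: linear_homotopic; [exact: cont_comp|by move=> ? ?|move=> x].
  exact: star_supp (realizationP x).
rewrite (_ : F \o G = idfun); first by apply: homotopic_refl; move=> ? ?.
apply/funext => y; apply: val_inj => /=.
exact: star_sphereK (sP y).
Qed.

End StarForest.

End Topology.

Local Open Scope nat_scope.
Local Open Scope set_scope.

(** * Cycles of length 2 modulo 3 *)

Definition cycles2mod3 (V : finType) (e : rel V) := forall c : seq V,
  2 < size c -> cycle e c -> uniq c -> size c %% 3 = 2.

Lemma cycles2mod3P (G : sgraph) :
  no_cycle01mod3 G <-> cycles2mod3 (@adj G).
Proof.
rewrite /no_cycle01mod3 /is_cycle /length01mod3 /cycles2mod3; split=> h c.
  move=> c2 cc cu; have := h c; rewrite /ucycleb c2 cc cu => /(_ isT).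
  by have := ltn_pmod (size c) (isT : 0 < 3); lia.
by case/and3P=> c2 cc cu; have := h c c2 cc cu; lia.
Qed.

(** A chord splits a cycle of length [s] into two shorter cycles whose lengths add up to [s + 2].
    Both are 2 modulo 3 by induction, hence so is [s]. *)
Lemma induced_cycles_suffice (G : sgraph) :
  no_induced_cycle01mod3 G -> no_cycle01mod3 G.
Proof.
move=> ind; apply/cycles2mod3P => c; have [n] := ubnP (size c).
elim: n c => // n IH c cn c2 cc cu.
have [ci|] := boolP (is_induced_cycle c).
  have := ind c ci; rewrite /length01mod3.
  by have := ltn_pmod (size c) (isT : 0 < 3); lia.
rewrite /is_induced_cycle /is_cycle /ucycleb c2 cc cu /=.
case/forallPn=> x /forallPn[y]; rewrite negb_imply negb_or.
case/andP=> /and3P[xc yc xy] /andP[nx ny].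
have [i p cE] := rot_to xc.
have {}nx : y != next (x :: p) x by rewrite -cE next_rot.
have {}ny : x != next (x :: p) y by rewrite -cE next_rot.
have sE : size c = (size p).+1 by rewrite -(size_rot i) cE.
have yx : y != x by apply: contraTneq xy => ->; rewrite adj_irrefl.
have {}yc : y \in p by have := yc; rewrite -(mem_rot i) cE inE (negPf yx).
have {}cc : cycle (@adj G) (x :: p) by rewrite -cE rot_cycle.
have {}cu : uniq (x :: p) by rewrite -cE rot_uniq.
case/splitPr: yc cE sE nx ny cc cu => p1 p2 cE sE nx ny cc cu.
move: (cc) (cu); rewrite /= rcons_cat cat_path /= mem_cat cat_uniq !inE.
case/and3P=> h1 h2 h3 /and3P[+ u1 /and3P[+ yp2 u3]]; rewrite !negb_or.
move=> /and3P[xp1 _ xp2] /andP[yp1 u2].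
(* Both arcs are nonempty because [x] and [y] are not consecutive on the cycle; this makes the two
   parts shorter than [c]. *)
have p10 : 0 < size p1.
  by case: p1 nx {cE sE ny cc cu h1 h2 xp1 u1 u2 yp1} => //=; rewrite eqxx eqxx.
have p20 : 0 < size p2.
  case: p2 ny {cE sE nx cc cu h3 xp2 u2 u3 yp2} => //.
  rewrite next_nth inE mem_cat mem_head !orbT /= [x == y]eq_sym (negPf yx).
  rewrite index_cat (negPf yp1) /= eqxx addn0.
  by rewrite nth_default ?eqxx// size_cat /= addn1.
have yx' : adj y x by rewrite adj_sym.
move: sE; rewrite size_cat /= => sE.
have [s1 s2] : (size p1).+2 < n /\ (size p2).+2 < n.
  by rewrite sE in cn; clear -cn p10 p20; move: (size p1) (size p2) cn p10 p20 => k1 k2; lia.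
have : size (x :: rcons p1 y) %% 3 = 2.
  apply: IH; rewrite /= ?size_rcons //.
    by rewrite !rcons_path last_rcons h1 h2 yx'.
  by rewrite mem_rcons inE negb_or eq_sym yx xp1 rcons_uniq yp1 u1.
have : size (x :: y :: p2) %% 3 = 2.
  apply: IH => //=.
    by rewrite xy h3.
  by rewrite inE negb_or eq_sym yx xp2 yp2.
by rewrite /= size_rcons; clear -sE; lia.
Qed.

Section Cycles.
Variables (V : finType) (e : rel V) (ei : irreflexive e).
Hypothesis good : cycles2mod3 e.

Lemma edge_neq x y : e x y -> x != y.
Proof. by apply: contraTneq => ->; rewrite ei. Qed.

Lemma no_triangle x y z : e x y -> e y z -> e z x -> False.
Proof.
move=> xy yz zx; suff: size [:: x; y; z] %% 3 = 2 by [].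
apply: good; rewrite //= ?xy ?yz ?zx// !inE negb_or.
by rewrite (edge_neq xy) (edge_neq yz) eq_sym (edge_neq zx).
Qed.

Lemma no_square x y z w : e x y -> e y z -> e z w -> e w x ->
  x != z -> y != w -> False.
Proof.
move=> xy yz zw wx xz yw; suff: size [:: x; y; z; w] %% 3 = 2 by [].
apply: good; rewrite //= ?xy ?yz ?zw ?wx// !inE !negb_or xz yw.
by rewrite (edge_neq xy) (edge_neq yz) (edge_neq zw) eq_sym (edge_neq wx).
Qed.

Lemma sub_cycles2mod3 (e' : rel V) : (forall x y, e' x y -> e x y) ->
  cycles2mod3 e'.
Proof. by move=> s c c2 /(sub_cycle s) cc; exact: good. Qed.

End Cycles.

(** * Reduction at a leaf *)

Section Domination.
Variable V : finType.
Implicit Types (e : rel V) (D : {set V}) (p : V * V) (s : seq (V * V)).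

Definition indep_dominating e D :=
  {in D &, forall x y, ~~ e x y} /\
  forall v, v \notin D -> exists2 u, u \in D & e u v.

Definition end_of (p : V * V) (x : V) := (x == p.1) || (x == p.2).

Definition covered s x := has (end_of^~ x) s.

Definition edge_dominating e s :=
  (forall p, p \in s -> e p.1 p.2) /\
  (forall x y, e x y -> covered s x || covered s y).

(* [i <= k <= gamma of the line graph]; edges are represented by ordered pairs. *)
Definition sandwiched e k :=
  (exists2 D, indep_dominating e D & #|D| <= k) /\
  (forall s, edge_dominating e s -> k <= size s).

Definition edge_count e := #|[set p : V * V | e p.1 p.2]|.

Lemma coveredP s x : reflect (exists2 p, p \in s & end_of p x) (covered s x).
Proof. exact: hasP. Qed.

Lemma covered_map s (f : V * V -> V * V) p x :
  p \in s -> end_of (f p) x -> covered [seq f q | q <- s] x.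
Proof. by move=> ps fx; apply/coveredP; exists (f p) => //; apply: map_f. Qed.

End Domination.

Section LeafStep.
Variables (V : finType) (e : rel V) (es : symmetric e) (ei : irreflexive e).
Hypothesis good : cycles2mod3 e.
Variables (a b : V).
Hypothesis bE : forall x, e b x = (x == a).

(** Edges at [a] are kept and all other edges at neighbours of [a] are deleted, so [a] with its
    neighbours becomes a star. *)
Definition leaf_rel : rel V := fun x y =>
  e x y && [|| x == a, y == a | ~~ e a x && ~~ e a y].

Let ab : e a b. Proof. by rewrite es bE. Qed.

Lemma leaf_sym : symmetric leaf_rel.
Proof.
move=> x y; rewrite /leaf_rel es; congr andb; rewrite orbCA; congr [|| _, _ | _].
exact: andbC.
Qed.

Lemma leaf_irrefl : irreflexive leaf_rel.
Proof. by move=> x; rewrite /leaf_rel ei. Qed.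

Lemma leaf_sub x y : leaf_rel x y -> e x y.
Proof. by case/andP. Qed.

Lemma leaf_good : cycles2mod3 leaf_rel.
Proof. exact (sub_cycles2mod3 good (@leaf_sub)). Qed.

Lemma leaf_nbr_a x : leaf_rel a x = e a x.
Proof. by rewrite /leaf_rel eqxx /= andbT. Qed.

Lemma leaf_edge_count w x :
  e a w -> e w x -> x != a -> edge_count leaf_rel < edge_count e.
Proof.
move=> aw wx xa; apply: proper_card; apply/properP; split.
  by apply/subsetP => p; rewrite !inE; exact: leaf_sub.
exists (w, x); rewrite !inE //= /leaf_rel wx (negPf xa) aw /= orbF.
by apply: contraTneq aw => ->; rewrite ei.
Qed.

(** A dominating set of the reduced graph contains [a] or [b], so trading its part inside the star
    for [a] alone does not enlarge it. Conversely, an edge dominating set of [e] is mapped, edge by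
    edge, to one of the reduced graph. *)
Lemma leaf_sandwiched k : sandwiched leaf_rel k -> sandwiched e k.
Proof.
case=> -[D [Di Dd] Dk] kle; split.
  pose R := [set x | (x != a) && ~~ e a x].
  have DR : #|D :&: R| < #|D|.
    have [u uD uR] : exists2 u, u \in D & u \notin R.
      have [bD|/Dd[u uD ub]] := boolP (b \in D).
        by exists b => //; rewrite inE ab andbF.
      by exists u => //; have := leaf_sub ub; rewrite es bE => /eqP ->; rewrite inE eqxx.
    apply: proper_card; rewrite properE subsetIl /=.
    by apply/subsetPn; exists u => //; rewrite inE (negPf uR) andbF.
  exists (a |: D :&: R); last first.
    by apply: leq_trans Dk; apply: leq_trans (leq_card_setU _ _) _; rewrite cards1.
  split=> [x y|v].
    rewrite !in_setU1 !in_setI !inE.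
    case/orP=> [/eqP->|/and3P[xD xa ax]]; case/orP=> [/eqP->|/and3P[yD ya ay]] //.
    - by rewrite ei.
    - by rewrite es.
    by apply: contra (Di x y xD yD); rewrite /leaf_rel => ->; rewrite ax ay !orbT.
  rewrite in_setU1 in_setI inE negb_or negb_and => /andP[va].
  rewrite va /= negbK; have [av|av] := boolP (e a v).
    by exists a => //; rewrite setU11.
  rewrite orbF => /Dd[u uD uv]; exists u; last exact: leaf_sub.
  have ua : u != a by apply: contraNneq av => <-; exact: leaf_sub.
  rewrite in_setU1 in_setI uD inE ua /=.
  case/andP: uv => _; rewrite (negPf ua) (negPf va) /=.
  by case/andP=> ->.
move=> s [sE sC].
(* [spare z] is a remaining edge at [z], or [ab] if there is none. An edge at [a] becomes [ab]; any
   other edge with an end adjacent to [a] becomes a spare edge at its other end. *)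
pose spare z := if [pick y | leaf_rel z y] is Some y then (z, y) else (a, b).
pose f p := if end_of p a then (a, b) else
  if e a p.1 then spare p.2 else if e a p.2 then spare p.1 else p.
rewrite -(size_map f s); apply: kle.
have spareE z : leaf_rel (spare z).1 (spare z).2.
  rewrite /spare; case: pickP => [y //|_] /=.
  by rewrite leaf_nbr_a.
split=> [_ /mapP[p ps ->]|x y].
  rewrite /f /end_of; case: ifP => [_|]; first by rewrite /= leaf_nbr_a.
  move/negbT; rewrite negb_or => /andP[p1 p2].
  case: ifP => // p1a; case: ifP => // p2a.
  by rewrite /leaf_rel sE // p1a p2a !orbT.
have ca : covered [seq f q | q <- s] a.
  suff [p ps pa] : exists2 p, p \in s & end_of p a.
    by apply: (covered_map ps); rewrite /f pa /end_of eqxx.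
  have /orP[/coveredP//|/coveredP[p ps pb]] := sC a b ab.
  exists p => //; have := sE p ps; case/orP: pb => /eqP <-.
    by rewrite bE /end_of eq_sym => ->; rewrite orbT.
  by rewrite es bE /end_of eq_sym => ->.
have key z w : leaf_rel z w -> z != a -> ~~ e a z -> covered s z ->
    covered [seq f q | q <- s] z.
  move=> zw za az /coveredP[p ps pz].
  have sp : spare z = (z, (spare z).2).
    by rewrite /spare; case: pickP => [u //|/(_ w)]; rewrite zw.
  apply: (covered_map ps); rewrite /f; have pE := sE p ps.
  have -> : end_of p a = false.
    apply/negP => pa; move: za az; case/orP: pz => /eqP zE; case/orP: pa => /eqP aE.
    - by rewrite zE aE eqxx.
    - by rewrite zE aE es pE.
    - by rewrite zE aE pE.
    - by rewrite zE aE eqxx.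
  case/orP: pz => /eqP zE; rewrite -zE (negPf az).
    by case: ifP => _; rewrite 1?sp /end_of /= -?zE eqxx.
  by case: ifP => _; rewrite 1?sp /end_of /= -?zE eqxx ?orbT.
move=> xy; case/andP: (xy) => exy.
have [->|xa] := eqVneq x a; first by rewrite ca.
have [->|ya] /= := eqVneq y a; first by rewrite ca orbT.
case/andP=> ax ay; have /orP[c|c] := sC x y exy.
  by rewrite (key x y).
by rewrite (key y x) ?orbT// leaf_sym.
Qed.

(** Without triangles no edge joins two neighbours of [a], so the deleted edges run from the
    neighbours of [a] other than [b] to the vertices outside the star. The auxiliary vertex is [b]:
    its only neighbour [a] is adjacent to all of the first set. *)
Lemma leaf_equivalent (R : realType) :
  homotopy_equivalent R
    (realization R (independence_complex (SGraph es ei)))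
    (realization R (independence_complex (SGraph leaf_sym leaf_irrefl))).
Proof.
apply: (@toggle_equivalent _ _ _ _ es ei leaf_sym leaf_irrefl
  [set x | e a x && (x != b)] [set x | (x != a) && ~~ e a x] b).
- by move=> x; rewrite !inE => /andP[-> _]; rewrite andbF.
- by rewrite inE eqxx andbF.
- by rewrite inE ab andbF.
- exact: leaf_sub.
- move=> x y xy; rewrite /leaf_rel !inE xy /=.
  have [->|xa] /= := eqVneq x a; first by constructor 1.
  have [->|ya] /= := eqVneq y a; first by constructor 1.
  have [ax|ax] /= := boolP (e a x).
    have ay : ~~ e a y.
      by apply/negP => ay; apply: (no_triangle ei good ax xy); rewrite es.
    constructor 2; rewrite ay andbT.
    by apply: contraTneq xy => ->; rewrite bE.
  have [ay|ay] /= := boolP (e a y); last by constructor 1.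
  constructor 3; apply: contraTneq xy => ->; rewrite es bE.
  by [].
- move=> p q z; rewrite !inE => /andP[ap _] _; rewrite bE => /eqP ->.
  by rewrite leaf_sym leaf_nbr_a ap.
Qed.

End LeafStep.

(** * Reduction at two adjacent vertices of degree two *)

Section PathStep.
Variables (V : finType) (e : rel V) (es : symmetric e) (ei : irreflexive e).
Hypothesis good : cycles2mod3 e.
Variables (a b c v : V).
Hypotheses (bE : forall x, e b x = (x == a) || (x == c)).
Hypotheses (cE : forall x, e c x = (x == b) || (x == v)).
Hypotheses (ac : a != c) (bv : b != v).

Definition far x := e a x && (x != b).

(** Three changes in turn: the [far] vertices are joined to [v], then separated from [a], and
    finally [c] is separated from [v]. This leaves [a b c] as a star with centre [b]. *)
Definition path_rel1 : rel V := fun x y =>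
  [|| e x y, far x && (y == v) | far y && (x == v)].

Definition path_rel2 : rel V := fun x y =>
  path_rel1 x y && ~~ ((x == a) && far y || (y == a) && far x).

Definition path_rel : rel V := fun x y =>
  path_rel2 x y && ~~ ((x == c) && (y == v) || (y == c) && (x == v)).

Let ab : e a b. Proof. by rewrite es bE eqxx. Qed.
Let bc : e b c. Proof. by rewrite bE eqxx orbT. Qed.
Let cv : e c v. Proof. by rewrite cE eqxx orbT. Qed.

Let ncb : c == b = false.
Proof. by apply: negbTE; rewrite eq_sym (edge_neq ei bc). Qed.
Let nab : a == b = false. Proof. by apply: negbTE; rewrite (edge_neq ei ab). Qed.
Let ncv : c == v = false. Proof. by apply: negbTE; rewrite (edge_neq ei cv). Qed.

Let nav : a == v = false.
Proof.
apply/negP => /eqP av; apply: (no_triangle ei good ab bc).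
by rewrite av.
Qed.

Let nac : e a c = false.
Proof. by apply/negP => h; apply: (no_triangle ei good ab bc); rewrite es. Qed.

Let navE : e a v = false.
Proof.
by apply/negP => h; apply: (no_square ei good ab bc cv); rewrite 1?es.
Qed.

Let far_a : far a = false. Proof. by rewrite /far ei. Qed.
Let far_b : far b = false. Proof. by rewrite /far eqxx andbF. Qed.
Let far_c : far c = false. Proof. by rewrite /far nac. Qed.
Let far_v : far v = false. Proof. by rewrite /far navE. Qed.

Let far_neq x y : far x -> far y = false -> (x == y) = false.
Proof. by move=> fx fy; apply: contraTF fx => /eqP->; rewrite fy. Qed.

Lemma path_rel1_sym : symmetric path_rel1.
Proof. by move=> x y; rewrite /path_rel1 es; congr orb; rewrite orbC. Qed.

Lemma path_rel1_irrefl : irreflexive path_rel1.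
Proof.
by move=> x; rewrite /path_rel1 ei orbb /=; apply/negP => /andP[+ /eqP xv];
  rewrite xv far_v.
Qed.

Lemma path_rel2_sym : symmetric path_rel2.
Proof. by move=> x y; rewrite /path_rel2 path_rel1_sym orbC. Qed.

Lemma path_rel2_irrefl : irreflexive path_rel2.
Proof. by move=> x; rewrite /path_rel2 path_rel1_irrefl. Qed.

Lemma path_rel_sym : symmetric path_rel.
Proof. by move=> x y; rewrite /path_rel path_rel2_sym orbC. Qed.

Lemma path_rel_irrefl : irreflexive path_rel.
Proof. by move=> x; rewrite /path_rel path_rel2_irrefl. Qed.

(* The three changes use [b], [c] and [a], in this order, as the auxiliary vertex
   of [toggle_equivalent]. *)
Lemma path_equivalent (R : realType) :
  homotopy_equivalent R
    (realization R (independence_complex (SGraph es ei)))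
    (realization R (independence_complex (SGraph path_rel_sym path_rel_irrefl))).
Proof.
apply: (@homotopy_equivalent_trans _ _
  (realization R (independence_complex (SGraph path_rel1_sym path_rel1_irrefl)))).
  apply: homotopy_equivalent_sym.
  apply: (@toggle_equivalent _ _ _ _ path_rel1_sym path_rel1_irrefl es ei
    [set x | far x] [set v] b).
  - by move=> x; rewrite !inE => fx /eqP xv; rewrite xv far_v in fx.
  - by rewrite inE far_b.
  - by rewrite inE.
  - by move=> x y xy; rewrite /path_rel1 xy.
  - by move=> x y; rewrite !inE => /or3P[h|h|/andP[h1 h2]];
      [constructor 1|constructor 2|constructor 3; rewrite h1 h2].
  move=> p q z; rewrite !inE => /andP[ap pb] /eqP->.
  rewrite /path_rel1 far_b (negPf bv) andbF !orbF bE => /orP[] /eqP->.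
    by rewrite es ap.
  by rewrite [e v c]es cv orbT.
apply: (@homotopy_equivalent_trans _ _
  (realization R (independence_complex (SGraph path_rel2_sym path_rel2_irrefl)))).
  apply: (@toggle_equivalent _ _ _ _ path_rel1_sym path_rel1_irrefl
    path_rel2_sym path_rel2_irrefl [set x | far x] [set a] c).
  - by move=> x; rewrite !inE => fx /eqP xa; rewrite xa far_a in fx.
  - by rewrite inE far_c.
  - by rewrite inE eq_sym.
  - by move=> x y /andP[].
  - move=> x y xy; rewrite !inE /path_rel2 xy /= negb_or.
    case h1: (_ && far y); first by constructor 3.
    case h2: (_ && far x); last by constructor 1.
    by constructor 2; rewrite andbC.
  move=> p q z; rewrite !inE => fp /eqP->.
  rewrite /path_rel1 far_c ncv andbF !orbF cE => /orP[] /eqP->.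
    by apply/orP; right; rewrite /path_rel2 /path_rel1 ab far_b far_a !andbF.
  apply/orP; left; rewrite /path_rel2 /path_rel1 fp eqxx far_v andbF orbT.
  by rewrite [v == a]eq_sym nav.
apply: (@toggle_equivalent _ _ _ _ path_rel2_sym path_rel2_irrefl
  path_rel_sym path_rel_irrefl [set c] [set v] a).
- by move=> x; rewrite !inE => /eqP-> /eqP vc; move: ncv; rewrite -vc eqxx.
- by rewrite inE.
- by rewrite inE nav.
- by move=> x y /andP[].
- move=> x y xy; rewrite !inE /path_rel xy /= negb_or.
  case h1: ((x == c) && _); first by constructor 2.
  case h2: ((y == c) && (x == v)); last by constructor 1.
  by constructor 3; rewrite andbC.
move=> p q z; rewrite !inE => /eqP-> /eqP-> /andP[].
rewrite /path_rel1 far_a nav /= andbF orbF eqxx /= => az.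
rewrite /far az negb_or negbK => /andP[/eqP zb _]; rewrite zb.
rewrite /path_rel /path_rel2 /path_rel1 [e c b]es bc far_c far_b !andbF /=.
by rewrite (negPf bv) andbF [b == c]eq_sym ncb.
Qed.

Lemma path_rel_a x : path_rel a x = (x == b).
Proof.
rewrite /path_rel /path_rel2 /path_rel1 eqxx far_a nav (negPf ac) /= !andbF !orbF.
rewrite andbT; have [->|xb] := eqVneq x b; first by rewrite ab far_b.
by rewrite /far xb andbT andbN.
Qed.

Lemma path_rel_c x : path_rel c x = (x == b).
Proof.
rewrite /path_rel /path_rel2 /path_rel1 eqxx far_c ncv cE.
rewrite [c == a]eq_sym (negPf ac) !andbF !orbF /= andbT.
have [->|xb] := eqVneq x b; first by rewrite (negPf bv).
by rewrite /= andbN.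
Qed.

Lemma path_rel_b x : path_rel b x = (x == a) || (x == c).
Proof.
rewrite /path_rel /path_rel2 /path_rel1 far_b bE (negPf bv) [b == c]eq_sym ncb.
by rewrite [b == a]eq_sym nab !andbF !orbF /= !andbT.
Qed.

Let outer x := [&& x != a, x != b & x != c].

Lemma path_rel_outer x y : outer x -> outer y ->
  path_rel x y = [|| e x y, far x && (y == v) | far y && (x == v)].
Proof.
move=> /and3P[xa xb xc] /and3P[ya yb yc].
by rewrite /path_rel /path_rel2 (negPf xa) (negPf ya) (negPf xc) (negPf yc) !andbT.
Qed.

Lemma far_outer x : far x -> outer x.
Proof. by move=> fx; rewrite /outer !(far_neq fx). Qed.

Let outer_v : outer v.
Proof. by rewrite /outer ![v == _]eq_sym nav bv ncv. Qed.

Lemma path_rel_outerW x y : outer x -> path_rel x y -> outer y.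
Proof.
move=> /and3P[xa xb xc] xy; apply/and3P; split; apply: contraTneq xy => ->.
- by rewrite path_rel_sym path_rel_a.
- by rewrite path_rel_sym path_rel_b negb_or xa.
- by rewrite path_rel_sym path_rel_c.
Qed.

Lemma path_relP x y : path_rel x y ->
  [\/ e x y, [/\ e x y = false, far x & y = v] |
      [/\ e x y = false, far y & x = v]].
Proof.
case/andP=> /andP[+ _] _; rewrite /path_rel1.
case: (e x y) => /=; first by constructor 1.
by case/orP=> /andP[fx /eqP->]; [constructor 2|constructor 3].
Qed.

Lemma path_edge_count : edge_count path_rel < edge_count e.
Proof.
(* A new edge from a [far] vertex to [v] stands for the deleted edge from that vertex to [a]; the
   edge [cv] is missed by [f], so the count drops. *)
pose f (p : V * V) := if e p.1 p.2 then p else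
  if p.2 == v then (p.1, a) else (a, p.2).
pose g (p : V * V) := if path_rel p.1 p.2 then p else
  if p.2 == a then (p.1, v) else (v, p.2).
have fa x : far x -> path_rel a x = false.
  by move=> fx; rewrite path_rel_a (far_neq fx).
have fK : {in [set p | path_rel p.1 p.2], cancel f g}.
  move=> [x y]; rewrite inE /= => xy; rewrite /f /=.
  case: (path_relP xy) => [exy|[exy fx yv]|[exy fy xv]]; rewrite exy /g /=.
  - by rewrite xy.
  - by rewrite yv eqxx /= path_rel_sym fa // eqxx.
  - by rewrite xv !(far_neq fy) //= fa.
rewrite /edge_count -(card_in_imset (can_in_inj fK)).
apply: proper_card; apply/properP; split.
  apply/subsetP => _ /imsetP[[x y] + ->]; rewrite !inE /f /=.
  case/path_relP => [exy|[exy /andP[ax _] yv]|[exy fy xv]].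
  - by rewrite exy.
  - by rewrite exy yv eqxx /= es.
  - by rewrite exy (far_neq fy) //=; case/andP: fy.
exists (c, v); first by rewrite inE.
apply/imsetP => -[[x y]]; rewrite inE /f /= => xy cvE.
case: (path_relP xy) cvE => [exy|[exy fx yv]|[exy fy xv]]; rewrite exy.
- by case=> cx vy; move: xy; rewrite -cx -vy path_rel_c eq_sym (negPf bv).
- by rewrite yv eqxx => -[_ va]; move: nav; rewrite va eqxx.
- by rewrite (far_neq fy) // => -[ca]; move: ac; rewrite ca eqxx.
Qed.

(** The two neighbours of [x] on the cycle would coincide. *)
Lemma cycle_unique_nbr (f : rel V) x y (p : seq V) :
  symmetric f -> (forall z, f x z -> z = y) ->
  1 < size p -> uniq (x :: p) -> cycle f (x :: p) -> False.
Proof.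
move=> fs fx; case: p => // z [//|w p] _; rewrite /= !inE !negb_or rcons_path.
case/and3P=> _ /andP[zw zp] _ /and3P[xz zw' /andP[_ lx]].
have := fx _ xz; have := fx (last w p); rewrite fs => /(_ lx) <- zl.
have := mem_last w p; rewrite -zl inE; by rewrite (negPf zw) (negPf zp).
Qed.

(** A cycle of the new graph avoids [a], [b] and [c]. Without new edges it is a cycle of [e]; with
    one new edge at [v], inserting [a b c] adds 3 to its length; with two, replacing [v] by [a]
    keeps its length. *)
Lemma path_good : cycles2mod3 path_rel.
Proof.
move=> C C2 cC uC.
have rotC x : x \in C -> exists p, [/\ size (x :: p) = size C, uniq (x :: p),
    cycle path_rel (x :: p) & C =i x :: p].
  move=> xC; have [i p CE] := rot_to xC; exists p; rewrite -CE.
  by rewrite size_rot rot_uniq rot_cycle; split=> // z; rewrite mem_rot.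
have noC x y : (forall z, path_rel x z -> z = y) -> x \notin C.
  move=> xy; apply/negP => /rotC[p [sp up cp _]].
  by apply: cycle_unique_nbr xy _ up cp; [exact: path_rel_sym|move: sp C2 => /= <-].
have aC : a \notin C by apply: (noC a b) => z; rewrite path_rel_a => /eqP.
have cC' : c \notin C by apply: (noC c b) => z; rewrite path_rel_c => /eqP.
have bC : b \notin C.
  apply/negP => bC; have [p [sp up cp Cp]] := rotC b bC.
  case: p sp up cp Cp => [|z p] sp up cp Cp; first by rewrite -sp in C2.
  case/andP: cp; rewrite path_rel_b => + _ => /orP[] /eqP zE.
    by move: aC; rewrite Cp zE !inE eqxx orbT.
  by move: cC'; rewrite Cp zE !inE eqxx orbT.
have outC x : x \in C -> outer x.
  by move=> xC; apply/and3P; split; apply: contraTneq xC => ->.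
have [vC|vC] := boolP (v \in C); last first.
  apply: good => //; apply: (sub_in_cycle (P := mem C)) cC; last exact/allP.
  move=> x y xC yC; rewrite path_rel_outer ?outC// => /or3P[//||] /andP[_ /eqP h].
    by rewrite -h yC in vC.
  by rewrite -h xC in vC.
have [p [sp up cp Cp]] := rotC v vC; rewrite -sp.
have out x : x \in p -> outer x by move=> xp; apply: outC; rewrite Cp inE xp orbT.
have nout x : ~~ outer x -> x \notin p by apply: contra; exact: out.
have ap : a \notin p by apply: nout; rewrite /outer eqxx.
have bp : b \notin p by apply: nout; rewrite /outer eqxx andbF.
have cp' : c \notin p by apply: nout; rewrite /outer eqxx !andbF.
have {sp C2} p2 : 1 < size p by move: C2; rewrite -sp.
case: p p2 up cp {Cp rotC} out {nout} ap bp cp' => // y p p2 up cp out ap bp cp'.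
have vE x : x \in y :: p -> path_rel v x -> e v x || far x.
  by move=> xp; rewrite (path_rel_outer outer_v (out x xp)) far_v /= eqxx andbT.
move: (up) (cp); rewrite /= rcons_path => /andP[vp up'] /and3P[vy yp lv].
have {}up' : uniq (y :: p) := up'.
have {}vy := vE y (mem_head _ _) vy.
have {}lv : e v (last y p) || far (last y p).
  by apply: vE; [exact: mem_last|rewrite path_rel_sym].
have {}yp : path e y p.
  apply: (sub_in_path (P := mem (y :: p))) yp; last exact/allP.
  move=> x z xp zp; rewrite path_rel_outer ?out// => /or3P[//||] /andP[_ /eqP h].
    by move: vp; rewrite -h zp.
  by move: vp; rewrite -h xp.
have ya x : far x -> e a x by case/andP.
have [evy|/negPf evy] := boolP (e v y); have [evl|/negPf evl] := boolP (e v (last y p)).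
- by apply: (@good (v :: y :: p)); rewrite //= rcons_path evy yp es.
- rewrite evl /= in lv.
  have : size ((v :: y :: p) ++ [:: a; b; c]) %% 3 = 2.
    apply: good; rewrite ?size_cat ?addn3 //.
      rewrite /= rcons_cat cat_path /= evy yp ab bc cv andbT.
      by rewrite es ya.
    rewrite cat_uniq up /= ![_ \in v :: y :: p]in_cons.
    by rewrite (negPf ap) (negPf bp) (negPf cp') nav (negPf bv) ncv !inE nab
      (negPf ac) [b == c]eq_sym ncb.
  by rewrite size_cat (modnDr _ 3).
- rewrite evy /= in vy.
  have : size ([:: v; c; b; a] ++ (y :: p)) %% 3 = 2.
    apply: good; rewrite ?size_cat //.
      by rewrite /= rcons_path yp ya // [e (last _ _) _]es evl [e v c]es cv
        [e c b]es bc [e b a]es ab.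
    move: vp ap bp cp' up'; move: (y :: p) => P vP aP bP cP uP.
    rewrite uniq_catC cat_uniq uP /= (negPf vP) (negPf aP) (negPf bP) (negPf cP).
    by rewrite !inE ![v == _]eq_sym ncv (negPf bv) nav ncb [c == a]eq_sym
      (negPf ac) [b == a]eq_sym nab.
  by rewrite size_cat -[_ + _]/(3 + (size p).+2) modnDl.
rewrite evy /= in vy; rewrite evl /= in lv.
have : size (a :: y :: p) %% 3 = 2 by apply: good; rewrite //= ?rcons_path ?ap ?ya// yp es ya.
by [].
Qed.

(** Since [b] is dominated, [D] meets [a b c]; its elements there are traded for a single one: [a]
    if [v] is in [D], [b] if [v] is dominated along an old edge, and [c] if [v] is dominated along
    new edges only. In the last case a [far] vertex of [D] dominates [a]. *)
Lemma path_indep_dominating D : indep_dominating path_rel D ->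
  exists2 D', indep_dominating e D' & #|D'| <= #|D|.
Proof.
move=> [Di Dd]; pose D0 := [set x in D | outer x].
have D0D : #|D0| < #|D|.
  have [x xD xo] : exists2 x, x \in D & ~~ outer x.
    have [bD|/Dd[x xD]] := boolP (b \in D).
      by exists b => //; rewrite /outer eqxx andbF.
    rewrite path_rel_sym path_rel_b => xac; exists x => //; rewrite /outer.
    by case/orP: xac => /eqP->; rewrite eqxx ?andbF.
  apply: proper_card; apply/properP; split.
    by apply/subsetP => y; rewrite inE => /andP[].
  by exists x => //; rewrite inE (negPf xo) andbF.
have D0o x : x \in D0 -> outer x by rewrite inE => /andP[].
have D0i : {in D0 &, forall x y, ~~ path_rel x y}.
  by move=> x y; rewrite !inE => /andP[xD _] /andP[yD _]; exact: Di.
have D0d x : outer x -> x \notin D0 -> exists2 u, u \in D0 & path_rel u x.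
  move=> xo; rewrite inE xo andbT => /Dd[u uD ux]; exists u => //.
  by rewrite inE uD; apply: path_rel_outerW xo _; rewrite path_rel_sym.
suff [m [mo mi md]] : exists m, [/\ ~~ outer m, forall x, x \in D0 -> ~~ e m x &
    forall x, x != m -> x \notin D0 -> e m x \/ exists2 u, u \in D0 & e u x].
  exists (m |: D0); last first.
    by apply: leq_trans D0D; rewrite cardsU1; case: (m \in D0).
  split=> [x y|x].
    case/setU1P=> [->|xD] /setU1P[->|yD]; rewrite ?ei ?mi //.
      by rewrite es mi.
    apply: contra (D0i x y xD yD) => xy.
    by rewrite path_rel_outer ?D0o// xy.
  rewrite in_setU1 negb_or => /andP[xm xD].
  have [mx|[u uD ux]] := md x xm xD; first by exists m; rewrite ?setU11.
  by exists u => //; rewrite in_setU1 uD orbT.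
have others x : outer x -> x != v -> x \notin D0 ->
    (exists2 u, u \in D0 & e u x) \/ far x /\ v \in D0.
  move=> xo xv /(D0d x xo)[u uD]; rewrite (path_rel_outer (D0o u uD) xo).
  rewrite (negPf xv) andbF /= => /orP[ux|/andP[fx /eqP uv]].
    by left; exists u.
  by right; rewrite -uv.
have split3 x : ~~ outer x -> [\/ x = a, x = b | x = c].
  rewrite /outer !negb_and !negbK => /or3P[] /eqP xE.
  - by constructor 1.
  - by constructor 2.
  - by constructor 3.
have Dnot x y : x \in D0 -> ~~ outer y -> x != y.
  by move=> /D0o xo; apply: contraNneq => <-.
have oa : ~~ outer a by rewrite /outer eqxx.
have ob : ~~ outer b by rewrite /outer eqxx andbF.
have oc : ~~ outer c by rewrite /outer eqxx !andbF.
have [vD|vD] := boolP (v \in D0).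
  exists a; split=> // [x xD|x xa xD].
    apply/negP => ax; have fx : far x by rewrite /far ax Dnot.
    have := D0i x v xD vD; rewrite path_rel_outer ?D0o// fx eqxx.
    by rewrite orbT.
  have [xo|/split3[]xE] := boolP (outer x); last 3 first.
  - by rewrite xE eqxx in xa.
  - by left; rewrite xE.
  - by right; exists v; rewrite // xE es.
  have xv : x != v by apply: contraNneq xD => ->.
  have [?|[/andP[ax _] _]] := others x xo xv xD; first by right.
  by left.
have others' x : outer x -> x != v -> x \notin D0 -> exists2 u, u \in D0 & e u x.
  by move=> xo xv /(others x xo xv)[//|[_]]; rewrite (negPf vD).
have [/existsP[u /andP[uD uv]]|/existsPn nu] := boolP [exists u, (u \in D0) && e u v].
  exists b; split=> // [x xD|x xb xD].
    by rewrite bE negb_or !Dnot.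
  have [xo|/split3[]xE] := boolP (outer x); last 3 first.
  - by left; rewrite xE es.
  - by rewrite xE eqxx in xb.
  - by left; rewrite xE.
  have [->|xv] := eqVneq x v; first by right; exists u.
  by right; apply: others'.
have [u uD] := D0d v outer_v vD.
rewrite (path_rel_outer (D0o u uD) outer_v) far_v eqxx andbT orbF.
have := nu u; rewrite uD /= => /negPf -> /= fu.
exists c; split=> // [x xD|x xc xD].
  rewrite cE negb_or Dnot //=.
  by apply: contraNneq vD => <-.
have [xo|/split3[]xE] := boolP (outer x); last 3 first.
- by right; exists u => //; rewrite xE es; case/andP: fu.
- by left; rewrite xE es.
- by rewrite xE eqxx in xc.
have [->|xv] := eqVneq x v; first by left.
by right; apply: others'.
Qed.

Section EdgeDomination.
Variables (u1 : V) (s : seq (V * V)).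
Hypotheses (fu1 : far u1) (se : edge_dominating e s).

Let has_ab := has (fun p => end_of p a && end_of p b) s.
Let has_bc := has (fun p => end_of p b && end_of p c) s.

(* An edge [a u] becomes [u v]; one of [ab], [bc], [cv] is turned into an edge at
   [b], and the others are traded for the edge [u1 v], which covers [v]. *)
Definition path_edge (p : V * V) : V * V :=
  if end_of p a then
    if end_of p b then (a, b) else (if p.1 == a then p.2 else p.1, v)
  else if end_of p b then (if has_ab then (u1, v) else (b, c))
  else if end_of p c then (if has_ab || has_bc then (u1, v) else (b, c))
  else p.

Lemma path_edge_dominating :
  edge_dominating path_rel [seq path_edge p | p <- s].
Proof.
have [sE sC] := se.
have far_path u : far u -> path_rel u v.
  by move=> fu; rewrite (path_rel_outer (far_outer fu) outer_v) fu eqxx orbT.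
have rbc : path_rel b c by rewrite path_rel_b eqxx orbT.
have rab : path_rel a b by rewrite path_rel_a.
have endE p x : p \in s -> end_of p x ->
    exists2 y, e x y & forall z, end_of p z = (z == x) || (z == y).
  move=> /sE pE /orP[] /eqP->; first by exists p.2.
  by exists p.1 => [|z]; [rewrite es|exact: orbC].
have end_b p : p \in s -> end_of p b -> end_of p a \/ end_of p c.
  move=> ps /(endE _ _ ps)[y]; rewrite bE => /orP[] /eqP-> zE; [left|right];
  by rewrite zE eqxx orbT.
split.
  move=> _ /mapP[p ps ->]; rewrite /path_edge; have pE := sE p ps.
  case: ifP => [pa|npa]; first case: ifP => [//|/negbT npb].
    apply: far_path; move: pa npb pE; rewrite /end_of negb_or.
    have [->|_] := eqVneq p.1 a.
      by move=> _ /andP[_ pb] ap; rewrite /far ap eq_sym.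
    by move=> /= /eqP <- /andP[pb _] pa; rewrite /far es pa eq_sym.
  case: ifP => [pb|npb].
    by case: has_ab => //=; apply: far_path.
  case: ifP => [pc|npc].
    by case: (_ || _) => //=; apply: far_path.
  move/negbT: npa; move/negbT: npb; move/negbT: npc; rewrite !negb_or.
  move=> /andP[c1 c2] /andP[b1 b2] /andP[a1 a2].
  by rewrite path_rel_outer ?pE // /outer ![_ == a]eq_sym ![_ == b]eq_sym
    ![_ == c]eq_sym ?a1 ?a2 ?b1 ?b2.
have cov p x : p \in s -> end_of (path_edge p) x ->
    covered [seq path_edge p | p <- s] x by exact: covered_map.
have endv p : p \in s -> end_of p a -> ~~ end_of p b ->
    covered [seq path_edge p | p <- s] v.
  by move=> ps pa pb; apply: (cov p _ ps); rewrite /path_edge pa (negPf pb) /end_of eqxx orbT.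
(* If neither [ab] nor [bc] lies in [s], then [s] covers the edge [bc] by means of [cv], which
   [path_edge] turns into [bc]. *)
have covb : covered [seq path_edge p | p <- s] b.
  have [/hasP[p ps /andP[pa pb]]|/hasPn nab'] := boolP has_ab.
    by apply: (cov p _ ps); rewrite /path_edge pa pb /end_of eqxx orbT.
  have nab0 : has_ab = false by apply/negbTE/hasPn.
  have [/hasP[p ps /andP[pb pc]]|/hasPn nbc'] := boolP has_bc.
    apply: (cov p _ ps); rewrite /path_edge pb nab0; have := nab' p ps; rewrite pb andbT.
    by move/negPf->; rewrite /end_of eqxx.
  have nbc0 : has_bc = false by apply/negbTE/hasPn.
  have /orP[/coveredP[p ps pb]|/coveredP[p ps pc]] := sC b c bc.
    have := nab' p ps; have := nbc' p ps; rewrite pb /= andbT => /negPf pc /negPf pa.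
    by have [] := end_b p ps pb; rewrite ?pc ?pa.
  have npb : end_of p b = false.
    by apply/negP => pb; have := nbc' p ps; rewrite pb pc.
  have npa : end_of p a = false.
    apply/negP => pa; have [y cy zE] := endE p c ps pc.
    move: pa cy; rewrite zE (negPf ac) /= => /eqP <-; by rewrite es nac.
  by apply: (cov p _ ps); rewrite /path_edge npa npb pc nab0 nbc0 /end_of eqxx.
have covo x : outer x -> covered s x -> covered [seq path_edge p | p <- s] x.
  move=> xo /coveredP[p ps px]; have [xa xb xc] := and3P xo.
  have [y xy zE] := endE p x ps px.
  have pE z : ~~ outer z -> end_of p z = (z == y).
    by move=> zo; rewrite zE; case: (eqVneq z x) zo => [->|//]; rewrite xo.
  have oa : ~~ outer a by rewrite /outer eqxx.
  have ob : ~~ outer b by rewrite /outer eqxx andbF.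
  have oc : ~~ outer c by rewrite /outer eqxx !andbF.
  have [pa|npa] := boolP (end_of p a).
    apply: (cov p _ ps); rewrite /path_edge pa.
    have ya : y = a by apply/esym/eqP; rewrite -pE.
    have -> : end_of p b = false by rewrite pE // ya eq_sym.
    move: px; rewrite /end_of /=; have [-> |p1a] := eqVneq p.1 a.
      by rewrite (negPf xa) /= => ->.
    have /eqP p2a : p.2 == a.
      by move: pa; rewrite /end_of eq_sym (negPf p1a) eq_sym.
    by rewrite p2a (negPf xa) orbF => ->.
  have [pb|npb] := boolP (end_of p b).
    have yb : y = b by apply/esym/eqP; rewrite -pE.
    by move: xy xa xc; rewrite yb es bE => /orP[] ->.
  have [pc|npc] := boolP (end_of p c).
    have yc : y = c by apply/esym/eqP; rewrite -pE.
    have xv : x = v.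
      by move: xy; rewrite yc es cE (negPf xb) => /eqP.
    (* Here [p] is [cv]. If it was turned into [bc], then [s] covers the edge [ab] by another edge
       at [a], whose image ends at [v]. *)
    have [hab|nab'] := boolP (has_ab || has_bc).
      apply: (cov p _ ps); rewrite /path_edge (negPf npa) (negPf npb) pc hab.
      by rewrite /end_of xv eqxx orbT.
    move: nab'; rewrite negb_or => /andP[/hasPn nab' /hasPn nbc'].
    have /orP[/coveredP[q qs qa]|/coveredP[q qs qb]] := sC a b ab.
      by rewrite xv; apply: (endv q qs qa); move: (nab' q qs); rewrite qa.
    have := nab' q qs; have := nbc' q qs; rewrite qb /= andbT => /negPf qc /negPf qa.
    by have [] := end_b q qs qb; rewrite ?qc ?qa.
  by apply: (cov p _ ps); rewrite /path_edge (negPf npa) (negPf npb) (negPf npc).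
(* The edge [a u] is covered at [u], or by an edge at [a] whose image ends at [v], or by [ab]. In
   the last case [cv] is covered at [v], or at [c] by an edge traded for [u1 v]. *)
have covv u : far u -> covered [seq path_edge p | p <- s] u ||
    covered [seq path_edge p | p <- s] v.
  move=> fu; have ou := far_outer fu; have /andP[au _] := fu.
  have /orP[|/(covo u ou)->//] := sC a u au.
  case/coveredP=> p ps pa; have [pb|pb] := boolP (end_of p b); last first.
    by rewrite (endv p ps pa pb) orbT.
  have hab : has_ab by apply/hasP; exists p => //; rewrite pa pb.
  have /orP[/coveredP[q qs qc]|/(covo v outer_v)->] := sC c v cv; last by rewrite orbT.
  have qa : end_of q a = false.
    apply/negP => qa; have [y cy zE] := endE q c qs qc.
    move: qa cy; rewrite zE (negPf ac) /= => /eqP <-; by rewrite es nac.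
  apply/orP; right; apply: (cov q _ qs); rewrite /path_edge qa qc hab.
  by case: ifP => _; rewrite /end_of eqxx orbT.
move=> x y xy; have [xo|xo] := boolP (outer x); last first.
  move: xo xy; rewrite /outer !negb_and !negbK => /or3P[] /eqP->.
  - by rewrite path_rel_a => /eqP->; rewrite covb orbT.
  - by rewrite covb.
  - by rewrite path_rel_c => /eqP->; rewrite covb orbT.
have yo := path_rel_outerW xo xy.
move: xy; rewrite path_rel_outer// => /or3P[xy|/andP[fx /eqP->]|/andP[fy /eqP->]].
- by have /orP[/(covo x xo)->//|/(covo y yo)->] := sC x y xy; rewrite orbT.
- exact: covv.
- by rewrite orbC covv.
Qed.

End EdgeDomination.

Lemma path_sandwiched k u1 : far u1 ->
  sandwiched path_rel k -> sandwiched e k.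
Proof.
move=> fu1 [[D DD Dk] kle]; split.
  have [D' D'D D'le] := path_indep_dominating DD.
  by exists D' => //; apply: leq_trans Dk.
move=> s se; rewrite -(size_map (path_edge u1 s) s).
exact/kle/path_edge_dominating.
Qed.

End PathStep.

(** * Existence of two adjacent vertices of degree two *)

(** Meant for cycles assembled from pieces of a path: their uniqueness becomes linear arithmetic on
    multiplicities. *)
Lemma uniq_le_count (T : eqType) (s t : seq T) :
  (forall x, count_mem x s <= count_mem x t) -> uniq t -> uniq s.
Proof.
move=> st ut; apply: count_mem_uniq => x.
have := st x; rewrite (count_uniq_mem x ut) -[x \in s]has_pred1 has_count.
by move: (count_mem x s) => [|[|n]]; case: (x \in t).
Qed.

Section Weight.
Variables (V : eqType) (r : rel V) (l : V -> V -> nat).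
Hypotheses (rs : symmetric r) (ls : forall x y, l x y = l y x).

Fixpoint weight x (p : seq V) : nat :=
  if p is y :: p' then l x y + weight y p' else 0.

Lemma weight_cat x p q : weight x (p ++ q) = weight x p + weight (last x p) q.
Proof. by elim: p x => //= y p IH x; rewrite IH addnA. Qed.

Lemma weight_rev x p y : weight y (rev (x :: p)) = weight x (rcons p y).
Proof.
elim: p x => [|z p IH] x; first by rewrite /= ls.
by rewrite rev_cons -cats1 weight_cat IH rev_cons last_rcons /= ls addnC addn0.
Qed.

Lemma path_rev x p y : path r y (rev (x :: p)) = path r x (rcons p y).
Proof.
elim: p x => [|z p IH] x; first by rewrite /= rs.
by rewrite rev_cons rcons_path IH rev_cons last_rcons /= rs andbC.
Qed.

Lemma last_rev (x : V) p y : last y (rev (x :: p)) = x.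
Proof. by rewrite rev_cons last_rcons. Qed.

End Weight.

(** * Weighted graphs of minimum degree three *)

Section WeightedGraph.
Variables (V : finType) (r : rel V) (l : V -> V -> nat) (Y : {set V}).
Hypotheses (rs : symmetric r) (ri : irreflexive r).
Hypotheses (ls : forall x y, l x y = l y x).
Hypothesis l3 : forall x y, r x y -> l x y %% 3 != 0.
Hypothesis rY : forall x y, r x y -> y \in Y.
Hypothesis deg3 : forall y, y \in Y -> 2 < #|[set z | r y z]|.
Hypothesis cyc : forall x p, 1 < size p -> uniq (x :: p) ->
  path r x (rcons p x) -> weight l x (rcons p x) %% 3 = 2.

Lemma third_nbr y u v : y \in Y ->
  exists w, [/\ r y w, w != u & w != v].
Proof.
move=> /deg3; rewrite (cardsD1 u) (cardsD1 v).
case: (posnP #|([set z | r y z] :\ u) :\ v|) => [->|/card_gt0P[w] + _].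
  by case: (_ \in _); case: (_ \in _).
by rewrite !inE => /and3P[wv wu yw]; exists w.
Qed.

(* The first five cycles force [A = 0], [l y z = l x z = 1] modulo 3, and the sixth
   one then has weight [2 + 2 * l y t] or [2 + 2 * l x q]. *)
Lemma weighted_step x s y z p2 q t :
  uniq (x :: rcons s y ++ z :: p2) ->
  path r x (rcons s y ++ z :: p2) ->
  r x z -> r x q -> r y t -> q \in p2 -> t \in p2 -> False.
Proof.
move=> U; rewrite cat_path rcons_path last_rcons /=.
case/and3P=> /andP[xs sy] yz zp xz xq yt qp tp.
have sym u v : r u v -> r v u by rewrite rs.
pose A := weight l x (rcons s y).
have l0 u v : r u v -> l u v %% 3 != 0 by exact: l3.
have cycU u p : 1 < size p ->
    (forall v, count_mem v (u :: p) <= count_mem v (x :: rcons s y ++ z :: p2)) ->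
    path r u (rcons p u) -> weight l u (rcons p u) %% 3 = 2.
  by move=> p1 up pp; apply: cyc => //; apply: uniq_le_count U.
(* The cycle made of the path from [x] to [z] and the edge [x z]. *)
have C1 : (A + (l y z + l x z)) %% 3 = 2.
  have : weight l x (rcons (rcons s y ++ [:: z]) x) %% 3 = 2.
    apply: cycU => [|v|]; first by rewrite size_cat size_rcons addn1.
      by rewrite /= !count_cat /= !addn0; clear; lia.
    by rewrite rcons_cat cat_path rcons_path last_rcons /= xs sy yz rs xz.
  by rewrite rcons_cat weight_cat last_rcons /= addn0 (ls z x).
(* Two cycles through the edge [x q'] and the path from [z] to [q']: one reaches [z] along [s] and
   [y], the other by the edge [x z]. *)
have C23 q' a1 a2 : p2 = a1 ++ q' :: a2 -> r x q' ->
    (A + (l y z + (weight l z (rcons a1 q') + l x q'))) %% 3 = 2 /\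
    (l x z + (weight l z (rcons a1 q') + l x q')) %% 3 = 2.
  move=> p2E xq'; move: zp; rewrite p2E cat_path /= => /and3P[za1 aq' _].
  split.
    have : weight l x (rcons (rcons s y ++ z :: rcons a1 q') x) %% 3 = 2.
      apply: cycU => [|v|]; first by rewrite size_cat !size_rcons /= size_rcons addnS.
        by rewrite p2E /= -!cats1 !count_cat /= !count_cat /= ?count_cat /=; clear; lia.
      by rewrite rcons_cat cat_path rcons_path last_rcons /= xs sy yz
        !rcons_path za1 aq' last_rcons rs xq'.
    by rewrite rcons_cat weight_cat last_rcons /= -[rcons (rcons _ _) _]cats1
      weight_cat last_rcons /= addn0 (ls q' x).
  have : weight l x (rcons (z :: rcons a1 q') x) %% 3 = 2.
    apply: cycU => [|v|]; first by rewrite /= size_rcons.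
      by rewrite p2E /= -!cats1 !count_cat /= !count_cat /= ?count_cat /=; clear; lia.
    by rewrite /= xz !rcons_path za1 aq' last_rcons rs xq'.
  by rewrite /= -[rcons (rcons _ _) _]cats1 weight_cat last_rcons /= addn0 (ls q' x).
(* Mirror image, with the edge [y t']: the first cycle runs from [y] back along [s] to [x] and then
   over [x z], the second uses [y z]. *)
have C45 t' b1 b2 : p2 = b1 ++ t' :: b2 -> r y t' ->
    (A + (l x z + (weight l z (rcons b1 t') + l y t'))) %% 3 = 2 /\
    (l y z + (weight l z (rcons b1 t') + l y t')) %% 3 = 2.
  move=> p2E yt'; move: zp; rewrite p2E cat_path /= => /and3P[zb1 bt' _].
  split.
    have : weight l y (rcons (rev (x :: s) ++ z :: rcons b1 t') y) %% 3 = 2.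
      apply: cycU => [|v|].
      + by rewrite size_cat size_rev /= size_rcons addSn addnS.
      + rewrite p2E /= -!cats1 !count_cat count_rev /= !count_cat /=; clear; lia.
      + by rewrite rcons_cat cat_path path_rev // last_rev rcons_path xs sy /= xz
          !rcons_path zb1 bt' last_rcons rs yt'.
    by rewrite rcons_cat weight_cat last_rev weight_rev // /= -[rcons (rcons b1 _) _]cats1
      weight_cat last_rcons /= addn0 (ls t' y).
  have : weight l y (rcons (z :: rcons b1 t') y) %% 3 = 2.
    apply: cycU => [|v|]; first by rewrite /= size_rcons.
      by rewrite p2E /= -!cats1 !count_cat /= !count_cat /= ?count_cat /=; clear; lia.
    by rewrite /= yz !rcons_path zb1 bt' last_rcons rs yt'.
  by rewrite /= -[rcons (rcons _ _) _]cats1 weight_cat last_rcons /= addn0 (ls t' y).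
(* Arithmetic shared by the three relative positions of [q] and [t]: [Bq] and [Bt] are the weights
   of the paths from [z] to them, and [M] that of the piece in between. *)
have fin Bq Bt M a b c d :
  (A + (a + b)) %% 3 = 2 -> (A + (a + (Bq + c))) %% 3 = 2 ->
  (b + (Bq + c)) %% 3 = 2 -> (A + (b + (Bt + d))) %% 3 = 2 ->
  (a + (Bt + d)) %% 3 = 2 -> Bq = Bt + M \/ Bt = Bq + M -> c %% 3 != 0 -> d %% 3 != 0 ->
  (b + (a + (d + (M + c)))) %% 3 = 2 -> False.
  by clear; lia.
case/splitPr: tp C45 C23 qp zp cycU {U} => b1 b2 C45 C23 qp zp cycU.
have [D4 D5] := C45 t b1 b2 erefl yt.
move: zp; rewrite cat_path /= => /and3P[zb1 b1t tb2].
move: qp; rewrite mem_cat inE => /or3P[qb|/eqP qt|qb].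
- case/splitPr: qb C23 D4 D5 cycU zb1 b1t {C45} => m0 m1 C23 D4 D5 cycU zb1 b1t.
  have [D2 D3] := C23 q m0 (m1 ++ t :: b2) (esym (catA _ (q :: m1) _)) xq.
  move: zb1 b1t; rewrite cat_path last_cat /= => /and3P[_ _ qm1] m1t.
  have D6 : (l x z + (l y z + (l y t + (weight l q (rcons m1 t) + l x q)))) %% 3 = 2.
    have : weight l y (rcons (z :: x :: q :: rcons m1 t) y) %% 3 = 2.
      apply: cycU => [//|v|].
        by rewrite /= -!cats1 !count_cat /= !count_cat /= ?count_cat /=; clear; lia.
      by rewrite /= yz [r z x]rs xz xq !rcons_path qm1 m1t last_rcons [r t y]rs yt.
    rewrite /= -[rcons (rcons m1 _) _]cats1 weight_cat last_rcons /= addn0.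
    rewrite (ls t y) (ls z x).
    by move=> h; apply: etrans h; congr (_ %% 3); clear; lia.
  apply: (fin _ _ (weight l q (rcons m1 t)) _ _ _ _ C1 D2 D3 D4 D5 _
    (l0 _ _ xq) (l0 _ _ yt) D6).
  by right; rewrite rcons_cat rcons_cons -cat_rcons weight_cat last_rcons.
- rewrite qt in xq.
  have [D2 D3] := C23 t b1 b2 erefl xq.
  have D6 : (l x z + (l y z + (l y t + (0 + l x t)))) %% 3 = 2.
    have : weight l x (rcons [:: z; y; t] x) %% 3 = 2.
      apply: cycU => [//|v|].
        by rewrite /= -!cats1 !count_cat /= !count_cat /= ?count_cat /=; clear; lia.
      by rewrite /= xz [r z y]rs yz yt rs xq.
    by rewrite /= !addn0 add0n (ls t x) (ls z y).
  by apply: (fin _ _ 0 _ _ _ _ C1 D2 D3 D4 D5 _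
    (l0 _ _ xq) (l0 _ _ yt) D6); left; rewrite addn0.
case/splitPr: qb C23 cycU tb2 {C45} => m1 m2 C23 cycU tb2.
have [D2 D3] := C23 q (b1 ++ t :: m1) m2 (catA _ (t :: m1) _) xq.
move: tb2; rewrite cat_path /= => /and3P[tm1 m1q _].
have D6 : (l x z + (l y z + (l y t + (weight l t (rcons m1 q) + l x q)))) %% 3 = 2.
  have : weight l x (rcons (z :: y :: t :: rcons m1 q) x) %% 3 = 2.
    apply: cycU => [//|v|].
      by rewrite /= -!cats1 !count_cat /= !count_cat /= ?count_cat /=; clear; lia.
    by rewrite /= xz [r z y]rs yz yt !rcons_path tm1 m1q last_rcons rs xq.
  by rewrite /= -[rcons (rcons m1 _) _]cats1 weight_cat last_rcons /= addn0
    (ls q x) (ls z y).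
apply: (fin _ _ (weight l t (rcons m1 q)) _ _ _ _ C1 D2 D3 D4 D5 _
    (l0 _ _ xq) (l0 _ _ yt) D6).
by left; rewrite rcons_cat rcons_cons -cat_rcons weight_cat last_rcons.
Qed.

Lemma split_not_head (h u : V) p : u \in p -> u != head h p ->
  exists a1 a2, p = a1 ++ u :: a2 /\ 0 < size a1.
Proof.
case/splitPr => [[|v a1]] a2 /=; first by rewrite eqxx.
by exists (v :: a1), a2.
Qed.

(* Induction on the position of the second neighbour of [x] on the path; the path
   is reversed up to that position. *)
Lemma maximal_paths_false N :
  (forall x p, x \in Y -> path r x p -> uniq (x :: p) -> size p = N ->
     forall z, r x z -> z \in p) ->
  forall j x p1 z p2, x \in Y -> path r x (p1 ++ z :: p2) ->
    uniq (x :: p1 ++ z :: p2) -> size (p1 ++ z :: p2) = N -> r x z ->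
    0 < size p1 -> size p1 <= j -> False.
Proof.
move=> ext; elim=> [|j IH] x p1 z p2 xY xp up sp xz p10 p1j.
  by case: p1 p10 p1j {xp up sp}.
case/lastP: p1 p10 p1j xp up sp => // s y _; rewrite size_rcons ltnS => sj xp up sp.
(* Apart from [b] and its successor on the path, [w] has a third neighbour, which lies on the path
   by maximality and beyond [b] by induction. *)
have close w a1 a2 b : w \in Y -> path r w (a1 ++ b :: a2) ->
    uniq (w :: a1 ++ b :: a2) -> size (a1 ++ b :: a2) = N -> size a1 = (size s).+1 ->
    exists2 q, r w q & (q != b) /\ q \in a2.
  move=> wY wp uw sw sa; have [q [wq qh qb]] := third_nbr (head w a1) b wY.
  exists q => //; split=> //.
  have := ext w _ wY wp uw sw q wq; rewrite mem_cat inE (negPf qb) /=.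
  case/orP=> // qa; have [c1 [c2 [aE c0]]] := split_not_head qa qh.
  exfalso; apply: (IH w c1 q (c2 ++ b :: a2)) => //; rewrite ?aE -?catA //=.
  - by move: wp; rewrite aE -catA.
  - by move: uw; rewrite aE -catA.
  - by move: sw; rewrite aE -catA.
  - by move: sa; rewrite aE size_cat /= addnS => -[sc]; apply: leq_trans sj;
      rewrite -sc leq_addr.
have [q xq [_ qp]] := close x (rcons s y) p2 z xY xp up sp (size_rcons _ _).
have xsy : path r x (rcons s y) by move: xp; rewrite cat_path => /andP[].
have yY : y \in Y by move: xsy; rewrite rcons_path => /andP[_ /rY].
(* Reversing the path up to [y] and continuing over the edge [x z] gives a path of the same length
   starting at [y]. *)
have [t yt [_ tp]] : exists2 t, r y t & (t != z) /\ t \in p2.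
  apply: (close y (rev (x :: s))) => //.
  - move: xp; rewrite !cat_path path_rev // last_rev last_rcons xsy /= xz.
    by case/andP.
  - apply: uniq_le_count up => v.
    by rewrite /= -!cats1 !count_cat count_rev /= ?count_cat /=; clear; lia.
  - by rewrite -sp !size_cat size_rev size_rcons.
  - by rewrite size_rev.
exact: weighted_step up xp xz xq yt qp tp.
Qed.

Lemma weighted_graph_empty : Y = set0.
Proof.
apply/setP => y0; rewrite inE; apply/negP => yY.
(* Induction on how far the length of a path is from [#|V|]: the hypothesis rules out longer paths,
   so the given one has maximal length. *)
suff noP m x p : x \in Y -> path r x p -> uniq (x :: p) -> #|V| <= size p + m -> False.
  by apply: (noP #|V| y0 [::]).
elim: m x p => [|m IH] x p xY xp up.
  rewrite addn0 => /leq_trans; move/(_ _ (leqnn _)) => Vp.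
  by have := max_card (mem (x :: p)); rewrite (card_uniqP up) /= ltnNge Vp.
move=> Vm; have ext x' p' : x' \in Y -> path r x' p' -> uniq (x' :: p') ->
    size p' = size p -> forall z, r x' z -> z \in p'.
  move=> x'Y xp' up' sp' z xz; apply: contraT => zp'; exfalso.
  apply: (IH z (x' :: p')); first exact: rY xz.
  - by rewrite /= rs xz.
  - rewrite cons_uniq up' inE negb_or zp' !andbT.
    by apply: contraTneq xz => ->; rewrite ri.
  - by rewrite /= sp' addSnnS.
have [z [xz zh _]] := third_nbr (head x p) x xY.
have zp := ext x p xY xp up erefl z xz.
have [p1 [p2 [pE p10]]] := split_not_head zp zh.
by apply: (maximal_paths_false ext (j := size p1) (x := x) (p1 := p1) (z := z) (p2 := p2));
  rewrite -?pE.
Qed.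

End WeightedGraph.

(** * Suppression of vertices of degree two *)

Section DegreeTwo.
Variables (V : finType) (e : rel V) (es : symmetric e) (ei : irreflexive e).
Hypothesis good : cycles2mod3 e.

Definition degree x := #|[set y | e x y]|.

Lemma degree2_nbrs m x y z : degree m = 2 -> e m x -> e m y -> x != y ->
  e m z -> (z == x) || (z == y).
Proof.
move=> m2 mx my xy mz; have sN : [set x; y] \subset [set y | e m y].
  by apply/subsetP => w /set2P[] ->; rewrite inE.
have /eqP N : [set x; y] == [set y | e m y].
  by rewrite eqEcard sN cards2 xy -[#|_|]/(degree m) m2.
by move/setP/(_ z): N; rewrite !inE mz.
Qed.

Lemma degree_gt1_other x y : 1 < degree x -> exists2 z, e x z & z != y.
Proof.
rewrite /degree (cardsD1 y).
case: (posnP #|[set y | e x y] :\ y|) => [->|/card_gt0P[w]].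
  by case: (_ \in _).
by rewrite !inE => /andP[wy xw] _; exists w.
Qed.

Variable U : {set V}.
Hypothesis Uclosed : forall x y, x \in U -> e x y -> y \in U.
Hypothesis Udeg : forall x, x \in U -> 1 < degree x.
Hypothesis nadj : forall x y, x \in U -> y \in U -> e x y ->
  degree x = 2 -> degree y = 2 -> False.

Let Y := [set x in U | 2 < degree x].

Definition middle x y := [pred m | [&& e x m, e m y & degree m == 2]].

Definition long_edge : rel V := fun x y =>
  [&& x \in Y, y \in Y & e x y || (x != y) && [exists m, middle x y m]].

Definition long_length (x y : V) := if e x y then 1 else 2.

Lemma long_sym : symmetric long_edge.
Proof.
move=> x y; rewrite /long_edge andbCA es [x == y]eq_sym.
congr [&& _, _ & _ || _ && _]; apply: eq_existsb => m /=.
by rewrite andbCA [e y m]es [e m x]es.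
Qed.

Lemma long_irrefl : irreflexive long_edge.
Proof. by move=> x; rewrite /long_edge ei eqxx /= !andbF. Qed.

Lemma YP x : reflect (x \in U /\ 2 < degree x) (x \in Y).
Proof. by rewrite inE; apply: andP. Qed.

(** A neighbour of [y] outside [Y] has degree 2, and its other neighbour lies in [Y]. Passing on to
    that vertex maps the neighbours of [y] to its neighbours along long edges, injectively because
    triangles and squares are absent. *)
Lemma long_degree y : y \in Y -> 2 < #|[set z | long_edge y z]|.
Proof.
move=> yY; have /YP[yU y2] := yY.
pose f z := if z \in Y then z else odflt z [pick w | e z w && (w != y)].
have fE z : e y z -> z \notin Y -> [/\ degree z = 2, e z (f z), f z != y & f z \in Y].
  move=> yz zY; have zU := Uclosed yU yz.
  have z2 : degree z = 2.
    apply/eqP; rewrite eqn_leq Udeg // andbT leqNgt.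
    by apply: contra zY => z2; apply/YP.
  rewrite /f (negPf zY); have [w zw wy] := degree_gt1_other y (Udeg zU).
  case: pickP => [u /andP[zu uy]|/(_ w)]; last by rewrite zw wy.
  have uU := Uclosed zU zu; split=> //; apply/YP; split=> //.
  rewrite ltn_neqAle eq_sym Udeg // andbT.
  by apply/eqP => u2; apply: nadj zU uU zu z2 u2.
have fY z : z \in Y -> f z = z by rewrite /f => ->.
have mix z z' : e y z -> e y z' -> z \in Y -> z' \notin Y -> f z = f z' -> False.
  move=> yz yz' zY zY'; rewrite fY // => zE; have [_ zw _ _] := fE _ yz' zY'.
  by rewrite -zE in zw; apply: (no_triangle ei good yz' zw); rewrite es.
have fI : {in [set z | e y z] &, injective f}.
  move=> z z'; rewrite !inE => yz yz' fz.
  have [zY|zY] := boolP (z \in Y); have [zY'|zY'] := boolP (z' \in Y).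
  - by rewrite -(fY z) // fz fY.
  - by case: (mix z z').
  - by case: (mix z' z).
  apply/eqP; apply: contraT => zz'; exfalso.
  have [_ zw wy _] := fE z yz zY; have [_ zw' _ _] := fE z' yz' zY'.
  rewrite -fz in zw'.
  apply: (no_square ei good yz zw (w := z')) => //; first by rewrite es.
    by rewrite es.
  by rewrite eq_sym.
apply: leq_trans y2 _; rewrite /degree -(card_in_imset fI).
apply/subset_leq_card/subsetP => _ /imsetP[z + ->]; rewrite !inE => yz.
have [zY|zY] := boolP (z \in Y); first by rewrite fY // /long_edge yY zY yz.
have [z2 zw wy wY] := fE z yz zY.
rewrite /long_edge yY wY eq_sym wy /=; apply/orP; right; apply/existsP; exists z.
by rewrite /= yz zw z2.
Qed.

Definition middle_of x y := odflt x [pick m | middle x y m].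

Fixpoint subdivide x (q : seq V) : seq V :=
  if q is y :: q' then
    (if e x y then [:: y] else [:: middle_of x y; y]) ++ subdivide y q'
  else [::].

Lemma size_subdivide x q : size (subdivide x q) = weight long_length x q.
Proof.
elim: q x => //= y q IH x; rewrite size_cat IH /long_length.
by case: ifP.
Qed.

Lemma middle_ofP x y : long_edge x y -> ~~ e x y ->
  [/\ x != y, e x (middle_of x y), e (middle_of x y) y & degree (middle_of x y) = 2].
Proof.
case/and3P=> _ _ /orP[->//|/andP[xy /existsP[m mP]] _].
rewrite /middle_of; case: pickP => [u /and3P[? ? /eqP ?]//|/(_ m)].
by rewrite mP.
Qed.

Lemma last_subdivide x q : last x (subdivide x q) = last x q.
Proof.
elim: q x => //= y q IH x; rewrite last_cat.
by case: ifP => _ /=; rewrite IH.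
Qed.

Lemma path_subdivide x q : path long_edge x q -> path e x (subdivide x q).
Proof.
elim: q x => //= y q IH x /andP[xy /IH yq]; rewrite cat_path.
have [exy|exy] := boolP (e x y); first by rewrite /= exy yq.
by have [_ h1 h2 _] := middle_ofP xy exy; rewrite /= h1 h2 yq.
Qed.

Lemma mem_subdivide x q m : path long_edge x q -> m \in subdivide x q ->
  m \in q \/ degree m = 2 /\
    exists q1 y z q2, [/\ x :: q = q1 ++ y :: z :: q2, e m y, e m z & y != z].
Proof.
elim: q x => //= y q IH x /andP[xy yq].
rewrite mem_cat => /orP[|/(IH y yq)[mq|[m2 [q1 [y' [z' [q2 [qE h1 h2 h3]]]]]]]]; first 1 last.
- by left; rewrite inE mq orbT.
- by right; split=> //; exists (x :: q1), y', z', q2; rewrite qE.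
have [exy|exy] := boolP (e x y); rewrite !inE.
  by move=> ->; left.
have [h0 h1 h2 h3] := middle_ofP xy exy.
case/orP=> [/eqP->|->]; last by left.
by right; split=> //; exists [::], x, y, q; rewrite es.
Qed.

Lemma path_long_mem x q v : path long_edge x q -> v \in q -> v \in Y.
Proof.
elim: q x => //= y q IH x /andP[/and3P[_ yY _] yq].
by rewrite inE => /orP[/eqP->//|/(IH y yq)].
Qed.

(** A middle vertex has degree 2 and so determines its two ends. As the vertices of [q] are
    distinct, it could be repeated only on a walk beginning [x y x], which the last hypothesis
    excludes. *)
Lemma uniq_subdivide x q : path long_edge x q -> uniq q ->
  (forall y q', q <> y :: x :: q') -> uniq (subdivide x q).
Proof.
elim: q x => //= y q IH x /andP[xy yq] /andP[ynq uq] nx.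
have us : uniq (subdivide y q).
  by apply: IH => // z q' qE; move: ynq; rewrite qE !inE eqxx orbT.
have yY : y \in Y by case/and3P: xy.
have degY v : v \in Y -> degree v = 2 -> False.
  by case/YP=> _ + v2; rewrite v2.
have ys : y \notin subdivide y q.
  apply/negP => /(mem_subdivide yq)[yq'|[y2 _]]; first by rewrite yq' in ynq.
  exact: degY y2.
have [exy|exy] := boolP (e x y); first by rewrite /= ys us.
have [xny h1 h2 h3] := middle_ofP xy exy; set m := middle_of x y in h1 h2 h3 *.
rewrite /= inE negb_or ys us !andbT; apply/andP; split.
  exact: edge_neq h2.
apply/negP => /(mem_subdivide yq)[mq|[_ [q1 [y' [z' [q2 [qE my mz yz]]]]]]].
  exact: degY (path_long_mem yq mq) h3.
have mx : e m x by rewrite es.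
have y'E := degree2_nbrs h3 mx h2 xny my.
have z'E := degree2_nbrs h3 mx h2 xny mz.
have zq : z' \in q.
  case: q1 qE => [|v q1] [_ ->]; first by rewrite mem_head.
  by rewrite mem_cat !inE eqxx !orbT.
have zx : z' = x.
  by case/orP: z'E => /eqP // zy; rewrite -zy zq in ynq.
have yy : y' = y.
  by case/orP: y'E => /eqP // yx; rewrite yx zx eqxx in yz.
case: q1 qE => [|v q1] [_ qE]; first by apply: (nx y q2); rewrite qE zx.
by move: ynq; rewrite qE yy mem_cat inE eqxx orbT.
Qed.

Lemma degree2_closed_empty : U = set0.
Proof.
have Y0 : Y = set0.
  apply: (@weighted_graph_empty V long_edge long_length Y long_sym long_irrefl).
  - by move=> x y; rewrite /long_length es.
  - by move=> x y _; rewrite /long_length; case: ifP.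
  - by move=> x y /and3P[].
  - exact: long_degree.
  move=> x p p1 up pp; rewrite -size_subdivide.
  have ls := last_subdivide x (rcons p x); rewrite last_rcons in ls.
  have uq : uniq (rcons p x) by rewrite -rot1_cons rot_uniq.
  have ps := path_subdivide pp.
  have us : uniq (subdivide x (rcons p x)).
    apply: uniq_subdivide => // y q' pE.
    case: p p1 up uq pE {pp ps ls} => [//|z [//|w p]] _ /= /andP[xp _] _ [_ wx _].
    by move: xp; rewrite wx !inE eqxx !orbT.
  have sz : 2 < size (subdivide x (rcons p x)).
    rewrite size_subdivide; case: p p1 {up pp ls uq ps us} => [//|y [//|z p]] _ /=.
    have h u v : 0 < long_length u v by rewrite /long_length; case: ifP.
    have h3 w q : 0 < size q -> 0 < weight long_length w q.
      by case: q => //= v q _; rewrite ltn_addr.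
    rewrite addnA; apply: (leq_add (leq_add (h x y) (h y z)) (h3 z (rcons p x) _)).
    by rewrite size_rcons.
  apply: good => //; move: us sz ls ps; case/lastP: (subdivide x (rcons p x)) => // c v _ _.
  rewrite last_rcons => -> ps.
  by rewrite -rot1_cons rot_cycle.
(* With [Y] empty every vertex of [U] has degree 2, so any edge in [U] contradicts [nadj]. *)
apply/setP => b; rewrite inE; apply/negP => bU.
have deg2 x : x \in U -> degree x = 2.
  move=> xU; apply/eqP; rewrite eqn_leq Udeg // andbT leqNgt.
  by apply/negP => x2; have := in_set0 x; rewrite -Y0 inE xU x2.
have [c bc _] := degree_gt1_other b (Udeg bU).
have cU := Uclosed bU bc.
exact: nadj bU cU bc (deg2 b bU) (deg2 c cU).
Qed.

End DegreeTwo.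

(** * Edge domination and vertex domination *)

Section EdgeVersusVertexDomination.
Variables (V : finType) (e : rel V) (es : symmetric e) (ei : irreflexive e).
Hypothesis good : cycles2mod3 e.
Variable D : {set V}.
Hypothesis Ddom : forall v, v \notin D -> exists2 u, u \in D & e u v.
Hypothesis nbr : forall x, exists y, e x y.

Definition dominator x := odflt x [pick u in D | e u x].

Lemma dominatorP x : x \notin D -> dominator x \in D /\ e (dominator x) x.
Proof.
move=> /Ddom[u uD ux]; rewrite /dominator; case: pickP => [w /andP[]//|/(_ u)].
by rewrite uD ux.
Qed.

(** These are the ends of the edges outside [D] that the representatives of the classes in [S] have
    to cover. *)
Definition active (S : {set V}) x := [&& x \notin D, dominator x \in S &
  [exists z, [&& z \notin D, e x z & dominator z \in S]]].

(* Walks are listed from their end: [:: y'; v; y; ...] with [y] and [y'] outside [D]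
   and [v] in [D] dominating both, so that positions 1 modulo 3 lie in [D]. *)
Definition alternating (W : seq V) :=
  [/\ size W %% 3 = 0, uniq W, sorted e W,
      forall u, u \in W -> u \notin D -> dominator u \in W &
      forall u i, i < size W -> (nth u W i \in D) = (i %% 3 == 1)].

(** Otherwise the walk closes up. With [z] at position [i], not 1 modulo 3, there is a cycle of
    length [i + 1]; with its dominator at position [i], which is 1 modulo 3, adding [z] gives a
    cycle of length [i + 2], a multiple of 3. *)
Lemma alternating_fresh y w z : alternating (y :: w) -> z \notin D -> e y z ->
  (z \notin y :: w) && (dominator z \notin y :: w).
Proof.
move=> [W3 uW sW gW nW] zD yz; have [gD gz] := dominatorP zD.
have cyc W1 u W2 c : y :: w = W1 ++ u :: W2 ->
    (c = [::] /\ u = z) \/ (c = [:: z] /\ u = dominator z) ->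
    z \notin y :: w \/ c = [::] -> 2 < size (c ++ rcons W1 u) ->
    size (c ++ rcons W1 u) %% 3 = 2.
  move=> WE cu zW sz; apply: good => //.
    case: W1 WE {sz} => [|v W1] [yE WE].
      case: cu => -[-> uE]; first by rewrite yE uE ei in yz.
      by rewrite /= uE gz [e z _]es gz.
    have yp : path e y (rcons W1 u).
      by move: sW; rewrite /= WE -cat_rcons cat_path => /andP[].
    rewrite -yE; case: cu => -[-> uE] /=.
      by rewrite rcons_path yp last_rcons uE es.
    by rewrite es yz rcons_path yp last_rcons uE gz.
  have u1 : uniq (rcons W1 u).
    by move: uW; rewrite WE -cat_rcons cat_uniq => /andP[].
  case: cu => -[cE uE]; rewrite cE // cat_cons /= u1 andbT.
  case: zW => [|c0]; last by rewrite cE in c0.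
  by rewrite WE -cat_rcons mem_cat negb_or => /andP[].
have nWE W1 u W2 : y :: w = W1 ++ u :: W2 -> (u \in D) = (size W1 %% 3 == 1).
  move=> WE; have := nW u (size W1); rewrite WE size_cat /= nth_cat ltnn subnn /=.
  by apply; rewrite addnS ltnS leq_addr.
have zW : z \notin y :: w.
  apply/negP => zW; case/splitPr E : {-1}(y :: w) / zW => [W1 W2].
  have := nWE W1 z W2 E; rewrite (negPf zD) => /esym/negbT z1.
  have sW1 : 0 < size W1.
    by case: W1 E {z1} => // -[yE _]; rewrite yE ei in yz.
  have := cyc W1 z W2 [::] E (or_introl (conj erefl erefl)) (or_intror erefl).
  by rewrite /= size_rcons; move: (size W1) z1 sW1; clear; lia.
rewrite zW /=; apply/negP => gW'.
case/splitPr E : {-1}(y :: w) / gW' => [W1 W2].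
have := nWE W1 _ W2 E; rewrite gD => /esym/eqP z1.
have := cyc W1 _ W2 [:: z] E (or_intror (conj erefl erefl)) (or_introl zW).
by rewrite /= size_rcons; move: (size W1) z1; clear; lia.
Qed.

(** If every class in [S] had two active vertices, an alternating walk could be prolonged for ever:
    from an active [y] to a neighbour [z] outside [D], on to the dominator of [z], and to another
    active vertex of that class. *)
Lemma peelable_class (S : {set V}) v0 : v0 \in S -> exists2 v, v \in S &
  forall x x', active S x -> active S x' -> dominator x = v -> dominator x' = v -> x = x'.
Proof.
move=> v0S.
have [/existsP[v /andP[vS /forallP vP]]|/existsPn H] := boolP [exists v, (v \in S) &&
    [forall x, forall x', [&& active S x, active S x', dominator x == v &
      dominator x' == v] ==> (x == x')]].
  exists v => // x x' ax ax' gx gx'; apply/eqP.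
  by move/forallP/(_ x')/implyP: (vP x); apply; rewrite ax ax' gx gx' eqxx.
exfalso; have two v : v \in S -> exists x x', [/\ active S x, active S x',
    dominator x = v, dominator x' = v & x != x'].
  move=> vS; have := H v; rewrite vS /= => /forallPn[x /forallPn[x']].
  rewrite negb_imply => /andP[/and4P[ax ax' /eqP gx /eqP gx'] xx'].
  by exists x, x'.
have actD x : active S x -> x \notin D by case/and3P.
have other z : dominator z \in S ->
    exists z', [/\ active S z', dominator z' = dominator z & z' != z].
  move=> /two[x [x' [ax ax' gx gx' xx']]].
  have [xz|xz] := eqVneq x z; last by exists x.
  by exists x'; split=> //; rewrite eq_sym -xz.
suff walk n : exists y w, [/\ alternating (y :: w), active S y & n < size (y :: w)].
  have [y [w [[_ uW _ _ _] _]]] := walk #|V|.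
  by rewrite ltnNge -(card_uniqP uW) max_card.
have step z z' W : alternating W -> z \notin D -> z' \notin D -> z' != z ->
    dominator z' = dominator z -> z \notin W -> dominator z \notin W ->
    path e z W -> alternating [:: z', dominator z, z & W].
  move=> [W3 uW sW gW nW] zD z'D zz' gz' zW gzW pW.
  have [gD gz] := dominatorP zD; have [_ gz''] := dominatorP z'D.
  have z'W : z' \notin W.
    by apply: contra gzW => /gW/(_ z'D); rewrite gz'.
  have ne a : a \notin D -> a != dominator z by apply: contraNneq => ->.
  split.
  - by rewrite /=; move: (size W) W3; clear; lia.
  - rewrite /= !inE !negb_or ne // zz' z'W eq_sym ne // gzW zW.
    exact: uW.
  - by rewrite /= pW gz es -gz' gz''.
  - move=> u; rewrite !inE => /or4P[/eqP->|/eqP->|/eqP->|/gW h] uD.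
    + by rewrite gz' eqxx !orbT.
    + by rewrite gD in uD.
    + by rewrite eqxx !orbT.
    + by rewrite h // !orbT.
  - move=> u [|[|[|i]]] //= iW; rewrite ?(negPf z'D) ?(negPf zD) ?gD //.
    by rewrite nW // -(modnDl 3 i).
elim: n => [|n [y [w [aW ay yw]]]].
  have [x [x' [ax ax' gx gx' xx']]] := two v0 v0S.
  exists x', [:: dominator x; x]; split=> //.
  apply: step; rewrite ?actD ?gx ?gx' //; last by rewrite eq_sym.
have /and3P[yD yS /existsP[z /and3P[zD yz zS]]] := ay.
have /andP[zW gzW] := alternating_fresh aW zD yz.
have [z' [az' gz' zz']] := other z zS.
exists z', [:: dominator z, z, y & w]; split=> //; last first.
  by rewrite /= ltnS; apply: leq_trans yw _; apply: leqW; apply: leqnSn.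
apply: step => //; first exact: actD az'.
by rewrite /= es yz; case: aW.
Qed.

(** Induction on [S]: a class with at most one active vertex is removed, and this vertex, if any,
    represents it. An edge to be covered with an end in that class has its representative as that
    end; the other edges are left to the induction hypothesis. *)
Lemma representatives (S : {set V}) : S \subset D -> exists f : V -> V,
  (forall v, v \in S -> e v (f v)) /\
  forall x y, x \notin D -> y \notin D -> e x y ->
    dominator x \in S -> dominator y \in S ->
    f (dominator x) = x \/ f (dominator y) = y.
Proof.
have [n] := ubnP #|S|; elim: n S => // n IH S Sn SD.
have [->|[v0 v0S]] := set_0Vmem S.
  by exists id; split=> [v|x y _ _ _]; rewrite inE.
have [v vS vP] := peelable_class v0S.
have [||f [fe fc]] := IH (S :\ v).
- by move: Sn; rewrite (cardsD1 v) vS.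
- by apply: subset_trans SD; apply: subD1set.
have [w vw] := nbr v.
(* The default [w] serves a class without active vertices, where any neighbour of [v] will do. *)
pose x0 := odflt w [pick x | active S x && (dominator x == v)].
have x0E x : active S x -> dominator x = v -> x0 = x.
  move=> ax gx; rewrite /x0; case: pickP => [x' /andP[ax' /eqP gx']|/(_ x)] /=.
    exact: vP.
  by rewrite ax gx eqxx.
have vx0 : e v x0.
  rewrite /x0; case: pickP => [x /andP[/and3P[xD _ _] /eqP <-]|_] //=.
  by case: (dominatorP xD).
exists (fun u => if u == v then x0 else f u); split=> [u uS|x y xD yD xy gx gy].
  by have [->//|uv] := eqVneq u v; apply: fe; rewrite !inE uv.
have ax : active S x.
  by rewrite /active xD gx; apply/existsP; exists y; rewrite yD xy.
have ay : active S y.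
  by rewrite /active yD gy; apply/existsP; exists x; rewrite xD es xy.
have [gxv|gxv] := eqVneq (dominator x) v; first by left; apply: x0E.
have [gyv|gyv] := eqVneq (dominator y) v; first by right; apply: x0E.
by apply: fc; rewrite // !inE ?gxv ?gyv.
Qed.

Lemma edge_domination_le : exists2 s, edge_dominating e s & size s = #|D|.
Proof.
have [f [fe fc]] := representatives (subxx D).
exists [seq (v, f v) | v <- enum D]; last by rewrite size_map -cardE.
have cov v x : v \in D -> end_of (v, f v) x ->
    covered [seq (v, f v) | v <- enum D] x.
  by move=> vD vx; apply/coveredP; exists (v, f v) => //; apply: map_f; rewrite mem_enum.
split=> [_ /mapP[v vD ->]|x y xy]; first by apply: fe; rewrite mem_enum in vD.
have [xD|xD] := boolP (x \in D); first by rewrite (cov x) // /end_of eqxx.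
have [yD|yD] := boolP (y \in D); first by rewrite (cov y y) ?orbT // /end_of eqxx.
have [gx _] := dominatorP xD; have [gy _] := dominatorP yD.
have [h|h] := fc x y xD yD xy gx gy.
  by rewrite (cov _ x gx) // /end_of h /= eqxx orbT.
by rewrite (cov _ y gy) ?orbT // /end_of h /= eqxx orbT.
Qed.

End EdgeVersusVertexDomination.

(** * Star forests *)

Section StarForestBase.
Variables (V : finType) (e : rel V).

Definition leaf x := degree e x == 1.

Definition mate x := odflt x [pick y | e x y].

(* In a component with a single edge, either end could serve as the center;
   [enum_rank] chooses one. *)
Definition center x :=
  if leaf x && (~~ leaf (mate x) || (enum_rank (mate x) < enum_rank x))
  then mate x else x.

Definition centers := [set x | center x == x].

Hypotheses (es : symmetric e) (ei : irreflexive e).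
Hypothesis nbr : forall x, exists y, e x y.
Hypothesis star_leaf : forall x y, e x y -> ~~ leaf x -> leaf y.

Lemma mateP x : e x (mate x).
Proof. by rewrite /mate; case: pickP => //= ne; have [y] := nbr x; rewrite ne. Qed.

Lemma leafE x y : leaf x -> e x y -> y = mate x.
Proof.
move=> /cards1P[z zE] xy; have := mateP x.
have : y \in [set y | e x y] by rewrite inE.
rewrite zE inE => /eqP-> xm; have : mate x \in [set y | e x y] by rewrite inE.
by rewrite zE inE => /eqP.
Qed.

(** One end is a leaf, say [x]. If [y] is not a leaf, it is the center of both; if it is, the
    component is a single edge and the ranks decide. *)
Lemma centerE x y : e x y ->
  center x = center y /\ (center x == x) (+) (center y == y).
Proof.
wlog lx : x y / leaf x.
  move=> h xy; have [lx|lx] := boolP (leaf x); first exact: h.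
  rewrite es in xy; have [|-> xy'] := h y x _ xy; last by rewrite addbC.
  by apply: star_leaf lx; rewrite es.
move=> xy; have yE := leafE lx xy; have xny := edge_neq ei xy.
rewrite /center lx -yE /=; have [ly|ly] /= := boolP (leaf y); last first.
  by rewrite eqxx addbT eq_sym xny.
rewrite -(leafE ly (y := x)) ?lx /=; last by rewrite es.
have : enum_rank x != enum_rank y by rewrite (inj_eq enum_rank_inj).
rewrite -val_eqE /=; have ynx : y == x = false by rewrite eq_sym (negPf xny).
by case: ltngtP => //= _ _; rewrite eqxx ?(negPf xny) ?ynx.
Qed.

Lemma centerP x y :
  e x y = (center x == center y) && ((center x == x) (+) (center y == y)).
Proof.
apply/idP/andP=> [/centerE[-> ->]//|[/eqP cxy]].
have key u w : center u = center w -> center u = u -> center w <> w -> e u w.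
  move=> cuw cu cw; rewrite -cu cuw; move: cw; rewrite /center.
  by case: ifP => // _ _; rewrite es; exact: mateP.
case: eqP => cx; case: eqP => cy // _; first exact: key.
by rewrite es; apply: key.
Qed.

Lemma center_mem x : center x \in centers.
Proof.
rewrite inE; have [/eqP xx|cx] := boolP (center x == x); first by rewrite xx xx.
have mE : center x = mate x by move: cx; rewrite /center; case: ifP => //; rewrite eqxx.
have [cxm] := centerE (mateP x).
by rewrite (negPf cx) /= mE.
Qed.

Lemma mate_center x : x \in centers -> center (mate x) = x /\ mate x != x.
Proof.
rewrite inE => /eqP cx; have [<- _] := centerE (mateP x); split=> //.
by rewrite eq_sym (edge_neq ei (mateP x)).
Qed.

(** The centers themselves form the independent dominating set. Each star has an edge, and only an
    edge of the same star can cover it, so an edge dominating set needs one edge per center. *)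
Lemma star_forest_sandwiched : sandwiched e #|centers|.
Proof.
split.
  exists centers => //; split=> [x y|v].
    by rewrite !inE centerP => -> ->; rewrite andbF.
  rewrite inE => cv; exists (center v); first exact: center_mem.
  have := center_mem v; rewrite inE => /eqP cc.
  by rewrite centerP cc !eqxx (negPf cv).
move=> s [sE sC].
rewrite cardE -(size_map (fun p : V * V => center p.1)).
apply: uniq_leq_size; first exact: enum_uniq.
move=> x; rewrite mem_enum => xA; have [mx _] := mate_center xA.
have cx : center x = x by move: xA; rewrite inE => /eqP.
have key z : center z = x -> covered s z -> x \in [seq center p.1 | p <- s].
  move=> zx /coveredP[p ps pz]; apply/mapP; exists p => //.
  have [pE _] := centerE (sE p ps).
  by case/orP: pz => /eqP zE; rewrite -zx zE.
by have /orP[/key->|/key->] := sC x (mate x) (mateP x).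
Qed.

Lemma star_forest_homotopy (R : realType) (v : V) :
  homotopy_equivalent R (realization R (independence_complex (SGraph es ei)))
    (sphere R #|centers|.-1).
Proof.
pose d := #|centers|.-1.
have dE : d.+1 = #|centers|.
  by rewrite prednK // card_gt0; apply/set0Pn; exists (center v); exact: center_mem.
pose a (i : 'I_d.+1) := nth v (enum centers) i.
pose k x : 'I_d.+1 := inord (index (center x) (enum centers)).
have aA i : a i \in centers by rewrite -mem_enum mem_nth // -cardE -dE.
have ac i : center (a i) = a i by have := aA i; rewrite inE => /eqP.
have ka x i : center x = a i -> k x = i.
  move=> cx; rewrite /k cx index_uniq ?enum_uniq ?inord_val //.
  by rewrite -cardE -dE.
have ak x : a (k x) = center x.
  rewrite /a /k inordK; first by rewrite nth_index // mem_enum center_mem.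
  by rewrite dE cardE index_mem mem_enum center_mem.
have aK : cancel a k by move=> i; apply: ka.
have lK : cancel (mate \o a) k by move=> i; apply: ka; case: (mate_center (aA i)).
have al i : (mate \o a) i != a i by case: (mate_center (aA i)).
have eE : e = star_rel k a.
  apply/funext => x; apply/funext => y; rewrite /star_rel centerP !ak.
  rewrite [x == center x]eq_sym [y == center y]eq_sym; congr andb.
  apply/eqP/eqP => [xy|/(congr1 a)].
    by apply: ka; rewrite ak xy.
  by rewrite !ak.
have := star_forest_sphere R aK lK al.
(* The two relations now coincide; only the proofs of symmetry and irreflexivity differ. *)
move: (star_sym _ _) (star_irrefl _ _); rewrite -eE => es' ei'.
by rewrite (Prop_irrelevance es' es) (Prop_irrelevance ei' ei).
Qed.

Lemma star_forest_nonempty (v : V) : 0 < #|centers|.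
Proof. by rewrite card_gt0; apply/set0Pn; exists (center v); exact: center_mem. Qed.

End StarForestBase.

(** * The theorem *)

Lemma degree_gt0 (V : finType) (e : rel V) x y : e x y -> 0 < degree e x.
Proof. by move=> xy; rewrite card_gt0; apply/set0Pn; exists y; rewrite inE. Qed.

Lemma leaf_nbrE (V : finType) (e : rel V) b a : degree e b = 1 -> e b a ->
  forall z, e b z = (z == a).
Proof.
move/eqP/cards1P=> [c cE] ba z.
have h w : e b w = (w == c) by move/setP/(_ w): cE; rewrite !inE.
by move: ba; rewrite !h => /eqP->.
Qed.

Theorem contractible_or_sphere (R : realType) (V : finType) (v0 : V) (e : rel V)
    (es : symmetric e) (ei : irreflexive e) : cycles2mod3 e ->
  contractible R (realization R (independence_complex (SGraph es ei))) \/
  (forall x, exists y, e x y) /\ exists k, [/\ 0 < k, sandwiched e k &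
    homotopy_equivalent R (realization R (independence_complex (SGraph es ei)))
      (sphere R k.-1)].
Proof.
have [n] := ubnP (edge_count e).
elim: n e es ei => // n IH e es ei en good.
have [/existsP[t /forallP et]|/existsPn noiso] := boolP [exists t, forall y, ~~ e t y].
  by left; apply: isolated_contractible et.
have nbr x : exists y, e x y by have /forallPn[y] := noiso x; rewrite negbK; exists y.
have reduce (e' : rel V) (es' : symmetric e') (ei' : irreflexive e') :
    edge_count e' < edge_count e -> cycles2mod3 e' ->
    (forall k, sandwiched e' k -> sandwiched e k) ->
    homotopy_equivalent R
      (realization R (independence_complex (SGraph es ei)))
      (realization R (independence_complex (SGraph es' ei'))) ->
    contractible R (realization R (independence_complex (SGraph es ei))) \/
    (forall x, exists y, e x y) /\ exists k, [/\ 0 < k, sandwiched e k &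
      homotopy_equivalent R (realization R (independence_complex (SGraph es ei)))
        (sphere R k.-1)].
  move=> e'e good' sand he; have [|//|c|[_ [k [k0 ke' hk]]]] := IH e' es' ei'.
  - by apply: leq_trans e'e _.
  - by left; apply: contractible_equivalent he c.
  right; split=> //; exists k; split=> //; first exact: sand.
  exact: homotopy_equivalent_trans he hk.
(* A leaf [b] whose component is not a star: the edge [w x] does not meet [a]. *)
have [/existsP[b /existsP[a /existsP[w /existsP[x]]]]|/existsPn noleaf] := boolP
    [exists b, exists a, exists w, exists x,
      [&& degree e b == 1, e b a, e a w, e w x & x != a]].
  case/and5P=> /eqP b1 ba aw wx xa; have bE := leaf_nbrE b1 ba.
  apply: (reduce (leaf_rel e a) (leaf_sym es a) (leaf_irrefl ei a)).
  - exact (leaf_edge_count ei aw wx xa).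
  - exact: leaf_good.
  - by move=> k ks; exact (leaf_sandwiched es ei bE ks).
  - exact (leaf_equivalent es ei good bE R).
have {}noleaf b a w x : degree e b = 1 -> e b a -> e a w -> e w x -> x = a.
  move=> b1 ba aw wx; apply/eqP; apply: contraT => xa.
  have /existsPn/(_ a)/existsPn/(_ w)/existsPn/(_ x) := noleaf b.
  by rewrite b1 ba aw wx xa.
have deg1 x : degree e x != 1 -> 1 < degree e x.
  by have [y xy] := nbr x; rewrite ltn_neqAle eq_sym (degree_gt0 xy) andbT.
(* The vertices outside the star components: once no leaf reduction applies, [U] is a union of
   components of minimum degree at least 2. *)
pose U := [set x | (1 < degree e x) && ~~ [exists y, e x y && (degree e y == 1)]].
have UP x : reflect (1 < degree e x /\ forall y, e x y -> degree e y != 1) (x \in U).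
  rewrite inE; apply: (iffP andP) => -[x1 xl]; split=> //.
    move=> y xy; apply: contra xl => y1; apply/existsP; exists y; exact/andP.
  by apply/existsPn => y; rewrite negb_and -implybE; apply/implyP/xl.
have Uclosed x y : x \in U -> e x y -> y \in U.
  move=> /UP[x1 xl] xy; apply/UP; split; first exact/deg1/xl.
  (* A leaf [b] at [y] would start a path [b y x z], which [noleaf] forbids. *)
  move=> b yb; apply/eqP => b1; have [z xz zy] := degree_gt1_other y x1.
  have yz : z = y by apply: noleaf b1 _ _ xz; rewrite es.
  by rewrite yz eqxx in zy.
have Udeg x : x \in U -> 1 < degree e x by case/UP.
have [/existsP[b /existsP[c]]|nopath] := boolP [exists b, exists c,
    [&& b \in U, c \in U, e b c, degree e b == 2 & degree e c == 2]].
  case/and5P=> bU cU bc /eqP b2 /eqP c2.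
  have [a ba ac] := degree_gt1_other c (Udeg b bU).
  have [v cv vb] := degree_gt1_other b (Udeg c cU).
  have bE x : e b x = (x == a) || (x == c).
    by apply/idP/idP => [|/orP[] /eqP-> //]; apply: degree2_nbrs.
  have cE x : e c x = (x == b) || (x == v).
    have cb : e c b by rewrite es.
    apply/idP/idP => [|/orP[] /eqP-> //]; apply: degree2_nbrs => //.
    by rewrite eq_sym.
  have bv : b != v by rewrite eq_sym.
  (* This second neighbour of [a] supplies the edge [u1 v] used in trading edges. *)
  have [u au ub] := degree_gt1_other b (Udeg a (Uclosed b a bU ba)).
  have fu : far e a b u by rewrite /far au.
  apply: (reduce (path_rel e a b c v) (path_rel_sym es a b c v)
    (path_rel_irrefl es ei good bE cE ac bv)).
  - exact (path_edge_count es ei good bE cE ac bv).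
  - exact (path_good es ei good bE cE ac bv).
  - by move=> k ks; exact (path_sandwiched es ei good bE cE ac bv fu ks).
  - exact (path_equivalent es ei good bE cE ac bv R).
have U0 : U = set0.
  apply: (degree2_closed_empty es ei good Uclosed Udeg) => x y xU yU xy x2 y2.
  by case/negP: nopath; apply/existsP; exists x; apply/existsP; exists y;
    rewrite xU yU xy x2 y2.
have star x y : e x y -> degree e x != 1 -> degree e y == 1.
  move=> xy /deg1 x1; apply: contraT => /deg1 y1; exfalso.
  have := in_set0 x; rewrite -U0 inE x1 /= => /negbFE/existsP[b /andP[xb /eqP b1]].
  have [z yz zx] := degree_gt1_other x y1.
  have : z = x by apply: noleaf b1 _ xy yz; rewrite es.
  exact/eqP.
right; split=> //; eexists; split; last exact: (star_forest_homotopy es ei nbr star R v0).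
  exact: star_forest_nonempty.
exact: star_forest_sandwiched.
Qed.

(** * Minima over finite types *)

Section Minima.
Variables (T : finType) (P : pred T) (F : T -> nat) (n : nat).

Lemma bigminn_le x : P x -> \big[minn/n]_(y | P y) F y <= F x.
Proof.
move=> Px; have := mem_index_enum x; rewrite -big_filter.
have : x \in [seq y <- index_enum T | P y] by rewrite mem_filter Px mem_index_enum.
elim: [seq y <- index_enum T | P y] => // y s IH; rewrite inE big_cons.
case/orP=> [/eqP<- _|xs xi]; first exact: geq_minl.
by apply: leq_trans (geq_minr _ _) _; apply: IH.
Qed.

(** If the iterated minimum equals the default [n], then [F x <= n] makes [x] itself a witness. *)
Lemma bigminn_witness x : P x -> F x <= n ->
  exists2 y, P y & \big[minn/n]_(z | P z) F z = F y.
Proof.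
move=> Px Fx; suff [//|E] :
    (exists2 y, P y & \big[minn/n]_(z | P z) F z = F y) \/
    \big[minn/n]_(z | P z) F z = n.
  by exists x => //; apply/eqP; rewrite eqn_leq bigminn_le // E Fx.
elim/big_ind: _; [by right| |by move=> y Py; left; exists y].
move=> a b [[y Py ->]|->] [[z Pz ->]|->].
- by case: (leqP (F y) (F z)) => _; left; [exists y|exists z].
- by case: (leqP (F y) n) => _; [left; exists y|right].
- by case: (leqP n (F z)) => _; [right|left; exists z].
- by right; rewrite minnn.
Qed.

End Minima.

(** * Edge dominating sets and the line graph *)

Section LineGraph.
Variable G : sgraph.
Implicit Types (A : {set line_graph G}) (s : seq (G * G)).

Lemma edgesP (E : {set G}) :
  reflect (exists2 p : G * G, adj p.1 p.2 & E = [set p.1; p.2]) (E \in edges G).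
Proof.
rewrite inE; apply: (iffP existsP) => [[x /existsP[y /andP[xy /eqP->]]]|[[x y] xy ->]].
  by exists (x, y).
by exists x; apply/existsP; exists y; rewrite xy eqxx.
Qed.

Lemma dominatesP (H : sgraph) (A : {set H}) v :
  reflect (v \in A \/ exists2 u, u \in A & adj u v) (dominates A v).
Proof.
apply: (iffP orP) => -[vA|h]; try by left.
  by right; have [u /andP[uA uv]] := existsP h; exists u.
by right; have [u uA uv] := h; apply/existsP; exists u; apply/andP.
Qed.

Lemma line_dominating_edges A : dominating A ->
  exists2 s, edge_dominating (@adj G) s & size s = #|A|.
Proof.
move=> /forallP Ad.
have ends (E : line_graph G) : {p : G * G | adj p.1 p.2 & val E = [set p.1; p.2]}.
  case: (pickP [pred p : G * G | adj p.1 p.2 && (val E == [set p.1; p.2])]).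
    by move=> p /andP[pE /eqP h]; exists p.
  move=> h; exfalso; have [p pE Ep] := edgesP _ (valP E).
  by have := h p; rewrite /= pE Ep eqxx.
pose f E := s2val (ends E).
have fE E : adj (f E).1 (f E).2 by rewrite /f; case: (ends E).
have fV (E : line_graph G) x : (x \in val E) = end_of (f E) x.
  by rewrite /f; case: (ends E) => p _ /= ->; rewrite !inE.
exists [seq f E | E <- enum A]; last by rewrite size_map -cardE.
split=> [_ /mapP[E _ ->]//|x y xy].
have xyE : [set x; y] \in edges G by apply/edgesP; exists (x, y).
pose E0 : line_graph G := exist _ [set x; y] xyE.
have cov (E : line_graph G) z : E \in A -> z \in val E -> covered [seq f E | E <- enum A] z.
  move=> EA zE; apply/coveredP; exists (f E); last by rewrite -fV.
  by apply: map_f; rewrite mem_enum.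
have [EA|[E EA /andP[_ /existsP[z /andP[zE]]]]] := dominatesP _ _ (Ad E0).
  by rewrite (cov E0 x) // set21.
by case/set2P=> <-; rewrite (cov E z) ?orbT.
Qed.

(** The size is only bounded, since [s] may list an edge twice or in both directions. *)
Lemma edges_line_dominating s : edge_dominating (@adj G) s ->
  exists2 A : {set line_graph G}, dominating A & #|A| <= size s.
Proof.
move=> [sE sC]; pose A : {set line_graph G} := [set E : line_graph G |
  has (fun p => val E == [set p.1; p.2]) s].
exists A; last first.
  rewrite cardE -(size_map val) -(size_map (fun p : G * G => [set p.1; p.2]) s).
  apply: uniq_leq_size; first by rewrite map_inj_uniq ?enum_uniq //; apply: val_inj.
  move=> _ /mapP[E + ->]; rewrite mem_enum inE => /hasP[p ps /eqP ->].
  by apply: map_f.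
apply/forallP => E; apply/dominatesP.
have [[x y] xy EE] := edgesP _ (valP E).
have [z zE /coveredP[p ps pz]] : exists2 z, z \in val E & covered s z.
  have /orP[c|c] := sC x y xy; [exists x|exists y] => //; rewrite EE.
    exact: set21.
  exact: set22.
have pE : [set p.1; p.2] \in edges G by apply/edgesP; exists p => //; apply: sE.
pose Ep : line_graph G := exist _ [set p.1; p.2] pE.
have EpA : Ep \in A by rewrite inE; apply/hasP; exists p.
have [<-|ne] := eqVneq Ep E; first by left.
right; exists Ep => //; apply/andP; split=> //.
by apply/existsP; exists z; rewrite zE andbT /= !inE.
Qed.

End LineGraph.

Theorem theorem1p3 (R : realType) (G : sgraph) (G_nonempty : (0 < #|G|)%N) :
  (no_cycle01mod3 G <-> no_induced_cycle01mod3 G) /\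
  (no_cycle01mod3 G ->
   ~ contractible R (realization R (independence_complex G)) ->
   exists d : nat,
     homotopy_equivalent R (realization R (independence_complex G))
                           (sphere R d) /\
     [/\ d.+1 = independent_domination_number G,
         independent_domination_number G = domination_number G &
         domination_number G = domination_number (line_graph G)]).
Proof.
split.
  split; last exact: induced_cycles_suffice.
  by move=> h c /andP[cc _]; apply: h.
move=> /cycles2mod3P good ncontr.
have [v0 _] := card_gt0P G_nonempty.
have [c|[nbr [k [k0 [[D [Di Dd] Dk] kle] he]]]] :
    contractible R (realization R (independence_complex G)) \/
    (forall x, exists y, @adj G x y) /\ exists k, [/\ 0 < k, sandwiched (@adj G) k &
      homotopy_equivalent R (realization R (independence_complex G))
        (sphere R k.-1)].
- case: G v0 good {G_nonempty ncontr} => V e es ei v0 good.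
  exact: contractible_or_sphere.
- by case: ncontr.
have D_dominating : dominating D.
  apply/forallP => v; apply/dominatesP; have [vD|/Dd] := boolP (v \in D); [by left|by right].
have D_indep : independent D.
  by apply/forall_inP => x xD; apply/forall_inP => y yD; apply: Di.
have ik : independent_domination_number G <= k.
  by apply: leq_trans Dk; apply: bigminn_le; rewrite D_indep.
have gi : domination_number G <= independent_domination_number G.
  rewrite /independent_domination_number.
  have [|A /andP[_ Ad] ->] := @bigminn_witness _
    (fun A : {set G} => independent A && dominating A) (fun A => #|A|) #|G| D _ (max_card _).
    by rewrite D_indep.
  exact: bigminn_le.
have mg : domination_number (line_graph G) <= domination_number G.
  rewrite [leqRHS]/domination_number.
  have [A /forallP Ad ->] := @bigminn_witness _
    (@dominating G) (fun A => #|A|) #|G| D D_dominating (max_card _).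
  have Ad' v : v \notin A -> exists2 u, u \in A & adj u v.
    by move=> vA; have [vA'|//] := dominatesP _ _ (Ad v); rewrite vA' in vA.
  have [s sd <-] := edge_domination_le (@adj_sym G) (@adj_irrefl G) good Ad' nbr.
  have [B Bd Bs] := edges_line_dominating sd.
  by apply: leq_trans Bs; apply: bigminn_le.
have km : k <= domination_number (line_graph G).
  have LT : dominating [set: line_graph G] by apply/forallP => v; rewrite /dominates inE.
  rewrite /domination_number.
  have [A Ad ->] := @bigminn_witness _ (@dominating (line_graph G)) (fun A => #|A|)
    #|line_graph G| [set: line_graph G] LT (max_card _).
  by have [s sd <-] := line_dominating_edges Ad; apply: kle.
(* The numbers lie on a closed chain of inequalities, and each equality follows by going round
   it. *)
exists k.-1; split=> //; rewrite prednK //; split; apply/eqP; rewrite eqn_leq.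
- by rewrite ik andbT (leq_trans km) // (leq_trans mg).
- by rewrite gi andbT (leq_trans ik) // (leq_trans km).
- by rewrite mg andbT (leq_trans gi) // (leq_trans ik).
Qed.
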